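(* Let $a\ge 3$ be an integer and let $\mathfrak g$ be the Kac-Moody Lie algebra over $\mathbb C$ with Cartan matrix $\begin{pmatrix}2&-a\\-a&2\end{pmatrix}$, with compact involution $\omega_0$. The $\mathfrak{sl}_2$-triples $\{X,Y,H\}$ of $\mathfrak g$ such that $X$ lies in the linear span of the real root vectors, $Y=\omega_0(X)$, and $H$ is dominant are exactly the $\mathfrak{sl}_2$-triples of the form $$X=c_0E_0+c_1E_1,\quad Y=\omega_0(X),\quad H=[X,Y],$$ with $c_0,c_1\in\mathbb C$, $0\neq E_0\in\mathfrak g_{F_{i+1}\alpha_0+F_i\alpha_1}$, $0\ne E_1\in\mathfrak g_{F_j\alpha_0+F_{j+1}\alpha_1}$, where $i,j\in\mathbb Z_{\ge0}$ satisfy $i\in\{j-1,j,j+1\}$.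
   Context: Let $e_i,f_i,h_i$ ($i=0,1$) be the Chevalley generators of $\mathfrak g$, $\mathfrak h=\mathbb Ch_0\oplus\mathbb Ch_1$ the Cartan subalgebra, $\alpha_0,\alpha_1$ the simple roots ($\langle h_i,\alpha_j\rangle=a_{ij}$, the entries of the Cartan matrix), $\mathfrak g_\gamma$ the root space of a root $\gamma$, and $\mathfrak n^+$ (resp. $\mathfrak n^-$) the subalgebra generated by the $e_i$ (resp. $f_i$). The compact involution $\omega_0$ is the antilinear automorphism of $\mathfrak g$ with $\omega_0(e_i)=-f_i$, $\omega_0(f_i)=-e_i$, $\omega_0(h)=-h$ for $h\in\mathfrak h_{\mathbb R}=\mathbb Rh_0\oplus\mathbb Rh_1$. An $\mathfrak{sl}_2$-triple in $\mathfrak g$ consists of nonzero elements $X\in\mathfrak n^+$, $Y\in\mathfrak n^-$, $H\in\mathfrak h$ with $[H,X]=2X$, $[H,Y]=-2Y$, $[X,Y]=H$. An element $h\in\mathfrak h$ is dominant if $\alpha_i(h)\ge0$ for $i=0,1$. A real root is a root in the Weyl group orbit of a simple root; a real root vector is a nonzero element of the root space of a real root. The sequence $F_n$ is defined by $F_0=0$, $F_1=1$, $F_{k+2}=aF_{k+1}-F_k$. The positive real roots of $\mathfrak g$ are exactly $F_{k+1}\alpha_0+F_k\alpha_1$ and $F_k\alpha_0+F_{k+1}\alpha_1$, $k\ge0$. *)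

(* Defs.v *)
From HB Require Import structures.
From mathcomp Require Import all_boot all_order all_algebra.
From mathcomp Require Import boolp classical_sets reals complex.

Set Implicit Arguments.
Unset Strict Implicit.
Unset Printing Implicit Defensive.

Import Order.TTheory GRing.Theory Num.Theory.
Local Open Scope classical_set_scope.
Local Open Scope ring_scope.
Local Open Scope quotient_scope.

HB.mixin Record Lmodule_isLieAlgebra (K : fieldType) L of GRing.Lmodule K L := {
  lie : L -> L -> L;
  lieDl : forall x y z, lie (x + y) z = lie x z + lie y z;
  lieDr : forall x y z, lie x (y + z) = lie x y + lie x z;
  lieZl : forall c x y, lie (c *: x) y = c *: lie x y;
  lieZr : forall c x y, lie x (c *: y) = c *: lie x y;
  liexx : forall x, lie x x = 0;
  lie_jacobi : forall x y z,
    lie x (lie y z) + lie y (lie z x) + lie z (lie x y) = 0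
}.

#[short(type="lieAlgType")]
HB.structure Definition LieAlgebra (K : fieldType) :=
  { L of GRing.Lmodule K L & Lmodule_isLieAlgebra K L }.

Section Subspaces.
Variables (K : fieldType) (L : lieAlgType K).

Definition is_subspace (U : set L) : Prop :=
  [/\ U 0, forall x y, U x -> U y -> U (x + y) & forall c x, U x -> U (c *: x)].

Definition is_subalgebra (U : set L) : Prop :=
  is_subspace U /\ forall x y, U x -> U y -> U (lie x y).

(* One-sided stability suffices, the bracket being antisymmetric. *)
Definition is_ideal (U : set L) : Prop :=
  is_subspace U /\ forall x y, U y -> U (lie x y).

Definition lin_span (S : set L) : set L := smallest is_subspace S.

Definition generated_subalgebra (S : set L) : set L := smallest is_subalgebra S.

Definition generated_ideal (S : set L) : set L := smallest is_ideal S.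

Lemma generated_ideal_is_ideal (S : set L) : is_ideal (generated_ideal S).
Proof.
split; first split.
- by move=> U [[[]]].
- by move=> x y Ux Uy U [idU SU]; case: (idU) => -[_ + _] _; apply;
    [apply: Ux | apply: Uy].
- by move=> c x Ux U [idU SU]; case: (idU) => -[_ _ +] _; apply; apply: Ux.
- by move=> x y Uy U [idU SU]; case: (idU) => _; apply; apply: Uy.
Qed.

End Subspaces.

Section QuotientAlgebra.
Variables (K : fieldType) (L : lieAlgType K) (I : set L) (idI : is_ideal I).

Let I0 : I 0. Proof. by case: idI => -[]. Qed.
Let ID x y : I x -> I y -> I (x + y). Proof. by case: idI => -[_ + _] _; apply. Qed.
Let IZ c x : I x -> I (c *: x). Proof. by case: idI => -[_ _ +] _; apply. Qed.
Let IN x : I x -> I (- x). Proof. by rewrite -scaleN1r; exact: IZ. Qed.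
Let Ilr x y : I y -> I (lie x y). Proof. by case: idI => _; apply. Qed.

Definition ideal_eq (x y : L) : bool := `[< I (x - y) >].

Lemma ideal_eq_refl : reflexive ideal_eq.
Proof. by move=> x; apply/asboolP; rewrite subrr. Qed.

Lemma ideal_eq_sym : symmetric ideal_eq.
Proof.
by move=> x y; apply/asboolP/asboolP => /IN; rewrite opprB.
Qed.

Lemma ideal_eq_trans : transitive ideal_eq.
Proof.
move=> y x z /asboolP xy /asboolP yz; apply/asboolP.
by have := ID xy yz; rewrite addrA subrK.
Qed.

Canonical ideal_equiv :=
  EquivRel ideal_eq ideal_eq_refl ideal_eq_sym ideal_eq_trans.

(* [idI] is taken as an argument so that the algebra structure below can be
   attached to the type. *)
Definition lie_quotient : Type := {eq_quot ideal_equiv}.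

HB.instance Definition _ := Choice.copy lie_quotient {eq_quot ideal_equiv}.

Definition lie_proj (x : L) : lie_quotient := \pi_{eq_quot ideal_equiv} x.
Definition lie_repr (u : lie_quotient) : L :=
  repr (u : {eq_quot ideal_equiv}).

Lemma lie_reprK : cancel lie_repr lie_proj. Proof. exact: reprK. Qed.

Lemma lie_projP x y : lie_proj x = lie_proj y <-> I (x - y).
Proof.
split=> [/eqP|Ixy]; first by rewrite /lie_proj eqmodE => /asboolP.
by apply/eqP; rewrite /lie_proj eqmodE; apply/asboolP.
Qed.

Let reprP x : I (lie_repr (lie_proj x) - x).
Proof. by apply/lie_projP; rewrite lie_reprK. Qed.

Definition lq_add u v := lie_proj (lie_repr u + lie_repr v).
Definition lq_opp u := lie_proj (- lie_repr u).
Definition lq_scale c u := lie_proj (c *: lie_repr u).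
Definition lq_lie u v := lie_proj (lie (lie_repr u) (lie_repr v)).

Lemma lq_addE x y : lq_add (lie_proj x) (lie_proj y) = lie_proj (x + y).
Proof.
by apply/lie_projP; rewrite opprD addrACA; apply: ID; apply: reprP.
Qed.

Lemma lq_oppE x : lq_opp (lie_proj x) = lie_proj (- x).
Proof. by apply/lie_projP; rewrite -opprD; apply: IN; apply: reprP. Qed.

Lemma lq_scaleE c x : lq_scale c (lie_proj x) = lie_proj (c *: x).
Proof. by apply/lie_projP; rewrite -scalerBr; apply: IZ; apply: reprP. Qed.

Let lieC (x y : L) : lie x y = - lie y x.
Proof.
apply/eqP; rewrite -addr_eq0; apply/eqP.
by have := liexx (x + y); rewrite lieDl !lieDr !liexx add0r addr0.
Qed.

Let lieBl (x y z : L) : lie (x - y) z = lie x z - lie y z.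
Proof. by rewrite lieDl -scaleN1r lieZl scaleN1r. Qed.

Let lieBr (x y z : L) : lie x (y - z) = lie x y - lie x z.
Proof. by rewrite lieDr -scaleN1r lieZr scaleN1r. Qed.

Lemma lq_lieE x y : lq_lie (lie_proj x) (lie_proj y) = lie_proj (lie x y).
Proof.
apply/lie_projP; set x' := lie_repr _; set y' := lie_repr _.
rewrite -[lie x' y'](subrK (lie x' y)) -addrA -lieBr -lieBl.
apply: ID; first by apply: Ilr; apply: reprP.
by rewrite lieC; apply: IN; apply: Ilr; apply: reprP.
Qed.

Let surj (P : lie_quotient -> Prop) : (forall x, P (lie_proj x)) -> forall u, P u.
Proof. by move=> Px u; rewrite -[u]lie_reprK. Qed.

Lemma lq_addA : associative lq_add.
Proof.
by do 3!elim/surj => ?; rewrite !lq_addE addrA.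
Qed.

Lemma lq_addC : commutative lq_add.
Proof. by do 2!elim/surj => ?; rewrite !lq_addE addrC. Qed.

Lemma lq_add0 : left_id (lie_proj 0) lq_add.
Proof. by elim/surj => ?; rewrite lq_addE add0r. Qed.

Lemma lq_addN : left_inverse (lie_proj 0) lq_opp lq_add.
Proof. by elim/surj => ?; rewrite lq_oppE lq_addE addNr. Qed.

HB.instance Definition _ :=
  GRing.isZmodule.Build lie_quotient lq_addA lq_addC lq_add0 lq_addN.

Lemma lq_scaleA a b u : lq_scale a (lq_scale b u) = lq_scale (a * b) u.
Proof. by elim/surj: u => ?; rewrite !lq_scaleE scalerA. Qed.

Lemma lq_scale1 : left_id 1 lq_scale.
Proof. by elim/surj => ?; rewrite lq_scaleE scale1r. Qed.

Lemma lq_scaleDr : right_distributive lq_scale +%R.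
Proof.
by move=> c; do 2!elim/surj => ?; rewrite /GRing.add /= !(lq_scaleE, lq_addE) scalerDr.
Qed.

Lemma lq_scaleDl u : {morph lq_scale^~ u : a b / a + b}.
Proof.
move=> a b; elim/surj: u => ?.
by rewrite [RHS]/GRing.add /= !(lq_scaleE, lq_addE) scalerDl.
Qed.

HB.instance Definition _ := GRing.Zmodule_isLmodule.Build K lie_quotient
  lq_scaleA lq_scale1 lq_scaleDr lq_scaleDl.

Lemma lie_projD x y : lie_proj (x + y) = lie_proj x + lie_proj y.
Proof. by rewrite -lq_addE. Qed.

Lemma lie_projZ c x : lie_proj (c *: x) = c *: lie_proj x.
Proof. by rewrite -lq_scaleE. Qed.

Lemma lq_lieDl u v w : lq_lie (u + v) w = lq_lie u w + lq_lie v w.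
Proof.
elim/surj: u => ?; elim/surj: v => ?; elim/surj: w => ?.
by rewrite -lie_projD !lq_lieE lieDl lie_projD.
Qed.

Lemma lq_lieDr u v w : lq_lie u (v + w) = lq_lie u v + lq_lie u w.
Proof.
elim/surj: u => ?; elim/surj: v => ?; elim/surj: w => ?.
by rewrite -lie_projD !lq_lieE lieDr lie_projD.
Qed.

Lemma lq_lieZl c u v : lq_lie (c *: u) v = c *: lq_lie u v.
Proof.
elim/surj: u => ?; elim/surj: v => ?.
by rewrite -lie_projZ !lq_lieE lieZl lie_projZ.
Qed.

Lemma lq_lieZr c u v : lq_lie u (c *: v) = c *: lq_lie u v.
Proof.
elim/surj: u => ?; elim/surj: v => ?.
by rewrite -lie_projZ !lq_lieE lieZr lie_projZ.
Qed.

Lemma lq_liexx u : lq_lie u u = 0.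
Proof. by elim/surj: u => ?; rewrite lq_lieE liexx. Qed.

Lemma lq_jacobi u v w :
  lq_lie u (lq_lie v w) + lq_lie v (lq_lie w u) + lq_lie w (lq_lie u v) = 0.
Proof.
elim/surj: u => ?; elim/surj: v => ?; elim/surj: w => ?.
by rewrite !lq_lieE -!lie_projD lie_jacobi.
Qed.

HB.instance Definition _ := Lmodule_isLieAlgebra.Build K lie_quotient
  lq_lieDl lq_lieDr lq_lieZl lq_lieZr lq_liexx lq_jacobi.

Lemma lie_proj_lie x y : lie_proj (lie x y) = lie (lie_proj x) (lie_proj y).
Proof. by rewrite -lq_lieE. Qed.

End QuotientAlgebra.

(* g~(A): the Lie algebra on generators e_i, f_i, h_i with the Chevalley
   relations, as Lie words modulo the congruence they generate. *)
Section TildeAlgebra.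
Variables (K : fieldType) (n : nat) (A : 'M[int]_n).

Inductive lie_word :=
| WZero
| WAdd of lie_word & lie_word
| WScale of K & lie_word
| WLie of lie_word & lie_word
| WE of 'I_n
| WF of 'I_n
| WH of 'I_n.

Inductive chevalley_eq : lie_word -> lie_word -> Prop :=
| ceq_refl x : chevalley_eq x x
| ceq_sym x y : chevalley_eq x y -> chevalley_eq y x
| ceq_trans x y z : chevalley_eq x y -> chevalley_eq y z -> chevalley_eq x z
| ceq_cadd x x' y y' : chevalley_eq x x' -> chevalley_eq y y' ->
    chevalley_eq (WAdd x y) (WAdd x' y')
| ceq_cscale c x x' : chevalley_eq x x' ->
    chevalley_eq (WScale c x) (WScale c x')
| ceq_clie x x' y y' : chevalley_eq x x' -> chevalley_eq y y' ->
    chevalley_eq (WLie x y) (WLie x' y')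
| ceq_addA x y z : chevalley_eq (WAdd x (WAdd y z)) (WAdd (WAdd x y) z)
| ceq_addC x y : chevalley_eq (WAdd x y) (WAdd y x)
| ceq_add0 x : chevalley_eq (WAdd WZero x) x
| ceq_scale0 x : chevalley_eq (WScale 0 x) WZero
| ceq_scale1 x : chevalley_eq (WScale 1 x) x
| ceq_scaleA a b x : chevalley_eq (WScale a (WScale b x)) (WScale (a * b) x)
| ceq_scaleDr c x y :
    chevalley_eq (WScale c (WAdd x y)) (WAdd (WScale c x) (WScale c y))
| ceq_scaleDl a b x :
    chevalley_eq (WScale (a + b) x) (WAdd (WScale a x) (WScale b x))
| ceq_lieDl x y z :
    chevalley_eq (WLie (WAdd x y) z) (WAdd (WLie x z) (WLie y z))
| ceq_lieDr x y z :
    chevalley_eq (WLie x (WAdd y z)) (WAdd (WLie x y) (WLie x z))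
| ceq_lieZl c x y : chevalley_eq (WLie (WScale c x) y) (WScale c (WLie x y))
| ceq_lieZr c x y : chevalley_eq (WLie x (WScale c y)) (WScale c (WLie x y))
| ceq_liexx x : chevalley_eq (WLie x x) WZero
| ceq_jacobi x y z :
    chevalley_eq (WAdd (WAdd (WLie x (WLie y z)) (WLie y (WLie z x)))
                       (WLie z (WLie x y))) WZero
| ceq_HH i j : chevalley_eq (WLie (WH i) (WH j)) WZero
| ceq_EF i : chevalley_eq (WLie (WE i) (WF i)) (WH i)
| ceq_EF0 i j : i != j -> chevalley_eq (WLie (WE i) (WF j)) WZero
| ceq_HE i j :
    chevalley_eq (WLie (WH i) (WE j)) (WScale (A i j)%:~R (WE j))
| ceq_HF i j :
    chevalley_eq (WLie (WH i) (WF j)) (WScale (- (A i j)%:~R) (WF j)).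

HB.instance Definition _ := gen_eqMixin lie_word.
HB.instance Definition _ := gen_choiceMixin lie_word.

Definition chevalley_eqb (x y : lie_word) : bool := `[< chevalley_eq x y >].

Lemma chevalley_eqb_refl : reflexive chevalley_eqb.
Proof. by move=> x; apply/asboolP; exact: ceq_refl. Qed.

Lemma chevalley_eqb_sym : symmetric chevalley_eqb.
Proof. by move=> x y; apply/asboolP/asboolP; exact: ceq_sym. Qed.

Lemma chevalley_eqb_trans : transitive chevalley_eqb.
Proof.
move=> y x z /asboolP xy /asboolP yz; apply/asboolP; exact: ceq_trans xy yz.
Qed.

Canonical chevalley_equiv := EquivRel chevalley_eqb
  chevalley_eqb_refl chevalley_eqb_sym chevalley_eqb_trans.

Definition km_tilde : Type := {eq_quot chevalley_equiv}.

HB.instance Definition _ := Choice.copy km_tilde {eq_quot chevalley_equiv}.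

Definition tproj (x : lie_word) : km_tilde := \pi_{eq_quot chevalley_equiv} x.
Definition trepr (u : km_tilde) : lie_word :=
  repr (u : {eq_quot chevalley_equiv}).

Lemma treprK : cancel trepr tproj. Proof. exact: reprK. Qed.

Lemma tprojP x y : tproj x = tproj y <-> chevalley_eq x y.
Proof.
split=> [/eqP|Ixy]; first by rewrite /tproj eqmodE => /asboolP.
by apply/eqP; rewrite /tproj eqmodE; apply/asboolP.
Qed.

Let reprP x : chevalley_eq (trepr (tproj x)) x.
Proof. by apply/tprojP; rewrite treprK. Qed.

Definition t_add u v := tproj (WAdd (trepr u) (trepr v)).
Definition t_scale c u := tproj (WScale c (trepr u)).
Definition t_lie u v := tproj (WLie (trepr u) (trepr v)).
Definition t_opp u := t_scale (-1) u.

Lemma t_addE x y : t_add (tproj x) (tproj y) = tproj (WAdd x y).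
Proof. by apply/tprojP; apply: ceq_cadd; apply: reprP. Qed.

Lemma t_scaleE c x : t_scale c (tproj x) = tproj (WScale c x).
Proof. by apply/tprojP; apply: ceq_cscale; apply: reprP. Qed.

Lemma t_lieE x y : t_lie (tproj x) (tproj y) = tproj (WLie x y).
Proof. by apply/tprojP; apply: ceq_clie; apply: reprP. Qed.

Let surj (P : km_tilde -> Prop) : (forall x, P (tproj x)) -> forall u, P u.
Proof. by move=> Px u; rewrite -[u]treprK. Qed.

Lemma t_addA : associative t_add.
Proof. by do 3!elim/surj => ?; rewrite !t_addE; apply/tprojP/ceq_addA. Qed.

Lemma t_addC : commutative t_add.
Proof. by do 2!elim/surj => ?; rewrite !t_addE; apply/tprojP/ceq_addC. Qed.

Lemma t_add0 : left_id (tproj WZero) t_add.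
Proof. by elim/surj => ?; rewrite t_addE; apply/tprojP/ceq_add0. Qed.

Lemma t_addN : left_inverse (tproj WZero) t_opp t_add.
Proof.
elim/surj => x; rewrite /t_opp t_scaleE t_addE; apply/tprojP.
apply: (ceq_trans (y := WAdd (WScale (-1) x) (WScale 1 x))).
  by apply: ceq_cadd; [exact: ceq_refl | exact/ceq_sym/ceq_scale1].
apply: (ceq_trans (ceq_sym (ceq_scaleDl _ _ _))).
by rewrite addNr; exact: ceq_scale0.
Qed.

HB.instance Definition _ :=
  GRing.isZmodule.Build km_tilde t_addA t_addC t_add0 t_addN.

Lemma t_scaleA a b u : t_scale a (t_scale b u) = t_scale (a * b) u.
Proof. by elim/surj: u => ?; rewrite !t_scaleE; apply/tprojP/ceq_scaleA. Qed.

Lemma t_scale1 : left_id 1 t_scale.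
Proof. by elim/surj => ?; rewrite t_scaleE; apply/tprojP/ceq_scale1. Qed.

Lemma tprojD x y : tproj (WAdd x y) = tproj x + tproj y.
Proof. by rewrite -t_addE. Qed.

Lemma t_scaleDr : right_distributive t_scale +%R.
Proof.
move=> c; do 2!elim/surj => ?; rewrite -tprojD !t_scaleE -tprojD.
exact/tprojP/ceq_scaleDr.
Qed.

Lemma t_scaleDl u : {morph t_scale^~ u : a b / a + b}.
Proof.
move=> a b; elim/surj: u => ?; rewrite !t_scaleE -tprojD.
exact/tprojP/ceq_scaleDl.
Qed.

HB.instance Definition _ := GRing.Zmodule_isLmodule.Build K km_tilde
  t_scaleA t_scale1 t_scaleDr t_scaleDl.

Lemma tprojZ c x : tproj (WScale c x) = c *: tproj x.
Proof. by rewrite -t_scaleE. Qed.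

Lemma t_lieDl u v w : t_lie (u + v) w = t_lie u w + t_lie v w.
Proof.
elim/surj: u => ?; elim/surj: v => ?; elim/surj: w => ?.
by rewrite -tprojD !t_lieE -tprojD; apply/tprojP/ceq_lieDl.
Qed.

Lemma t_lieDr u v w : t_lie u (v + w) = t_lie u v + t_lie u w.
Proof.
elim/surj: u => ?; elim/surj: v => ?; elim/surj: w => ?.
by rewrite -tprojD !t_lieE -tprojD; apply/tprojP/ceq_lieDr.
Qed.

Lemma t_lieZl c u v : t_lie (c *: u) v = c *: t_lie u v.
Proof.
elim/surj: u => ?; elim/surj: v => ?.
by rewrite -tprojZ !t_lieE -tprojZ; apply/tprojP/ceq_lieZl.
Qed.

Lemma t_lieZr c u v : t_lie u (c *: v) = c *: t_lie u v.
Proof.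
elim/surj: u => ?; elim/surj: v => ?.
by rewrite -tprojZ !t_lieE -tprojZ; apply/tprojP/ceq_lieZr.
Qed.

Lemma t_liexx u : t_lie u u = 0.
Proof. by elim/surj: u => ?; rewrite t_lieE; apply/tprojP/ceq_liexx. Qed.

Lemma t_jacobi u v w :
  t_lie u (t_lie v w) + t_lie v (t_lie w u) + t_lie w (t_lie u v) = 0.
Proof.
elim/surj: u => ?; elim/surj: v => ?; elim/surj: w => ?.
by rewrite !t_lieE -!tprojD; apply/tprojP/ceq_jacobi.
Qed.

HB.instance Definition _ := Lmodule_isLieAlgebra.Build K km_tilde
  t_lieDl t_lieDr t_lieZl t_lieZr t_liexx t_jacobi.

Lemma tproj_lie x y : tproj (WLie x y) = lie (tproj x) (tproj y).
Proof. by rewrite -t_lieE. Qed.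

End TildeAlgebra.

(* The Kac-Moody algebra g(A) = g~(A) / r, where r is the largest ideal meeting
   h trivially, i.e. the sum of all such ideals.  Taking h to be the span of
   the h_i is the right realization when A is nondegenerate, which holds for
   the rank 2 matrices considered below (det = 4 - a^2). *)
Section KacMoody.
Variables (K : fieldType) (n : nat) (A : 'M[int]_n).

Definition km_tilde_cartan : set (km_tilde K A) :=
  [set x | exists c : 'rV[K]_n, x = \sum_i c 0 i *: tproj A (WH K i)].

Definition km_radical : set (km_tilde K A) :=
  generated_ideal (\bigcup_(I in [set I | is_ideal I /\
                                  I `&` km_tilde_cartan `<=` [set 0]]) I).

Lemma km_radical_ideal : is_ideal km_radical.
Proof. exact: generated_ideal_is_ideal. Qed.

Definition kac_moody : Type := lie_quotient km_radical_ideal.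

HB.instance Definition _ := LieAlgebra.copy kac_moody (lie_quotient km_radical_ideal).

Definition km_proj (w : lie_word K n) : kac_moody :=
  lie_proj km_radical_ideal (tproj A w).

Definition chev_e (i : 'I_n) : kac_moody := km_proj (WE K i).
Definition chev_f (i : 'I_n) : kac_moody := km_proj (WF K i).
Definition chev_h (i : 'I_n) : kac_moody := km_proj (WH K i).

Definition npos : set kac_moody := generated_subalgebra (range chev_e).
Definition nneg : set kac_moody := generated_subalgebra (range chev_f).

(* An element of h is given by its coordinates on the h_i. *)
Definition cartan_elt (c : 'rV[K]_n) : kac_moody := \sum_i c 0 i *: chev_h i.

Definition cartan : set kac_moody := range cartan_elt.

(* [g : 'rV[int]_n] stands for the element \sum_j g_j alpha_j of the root
   lattice; [pair_coroot g i] is <h_i, g> and [weight_eval g c] is the value of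
   g at the element of h of coordinates c. *)
Definition simple_root (i : 'I_n) : 'rV[int]_n := delta_mx 0 i.

Definition pair_coroot (g : 'rV[int]_n) (i : 'I_n) : int :=
  \sum_j g 0 j * A i j.

Definition weight_eval (g : 'rV[int]_n) (c : 'rV[K]_n) : K :=
  \sum_i c 0 i * (pair_coroot g i)%:~R.

Definition root_space (g : 'rV[int]_n) : set kac_moody :=
  [set x | forall c, lie (cartan_elt c) x = weight_eval g c *: x].

Definition is_root (g : 'rV[int]_n) : Prop :=
  g != 0 /\ exists2 x, root_space g x & x != 0.

Definition simple_reflection (i : 'I_n) (g : 'rV[int]_n) : 'rV[int]_n :=
  g - pair_coroot g i *: simple_root i.

Definition weyl_orbit (g : 'rV[int]_n) : set 'rV[int]_n :=
  [set g' | exists s : seq 'I_n, g' = foldr simple_reflection g s].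

Definition is_real_root (g : 'rV[int]_n) : Prop :=
  is_root g /\ exists i, weyl_orbit (simple_root i) g.

Definition is_real_root_vector (x : kac_moody) : Prop :=
  x != 0 /\ exists2 g, is_real_root g & root_space g x.

Definition is_sl2_triple (X Y H : kac_moody) : Prop :=
  [/\ [/\ X != 0, Y != 0 & H != 0],
      [/\ npos X, nneg Y & cartan H] &
      [/\ lie H X = 2%:R *: X, lie H Y = - 2%:R *: Y & lie X Y = H]].

End KacMoody.

Section CompactInvolution.
Variables (K : numClosedFieldType) (n : nat) (A : 'M[int]_n).
Local Notation g := (kac_moody K A).

(* In a numClosedFieldType, [0 <= z] entails that z is real. *)
Definition is_dominant (H : g) : Prop :=
  exists2 c, H = cartan_elt A c &
    forall i, 0 <= weight_eval A (simple_root i) c.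

Definition real_cartan : set g :=
  [set x | exists2 c : 'rV[K]_n, (forall i, c 0 i \is Num.real) &
                                 x = cartan_elt A c].

Definition is_antilinear_automorphism (omega : g -> g) : Prop :=
  [/\ bijective omega,
      forall x y, omega (x + y) = omega x + omega y,
      forall c x, omega (c *: x) = c^* *: omega x &
      forall x y, omega (lie x y) = lie (omega x) (omega y)].

Definition is_compact_involution (omega : g -> g) : Prop :=
  [/\ is_antilinear_automorphism omega,
      forall i, omega (chev_e K A i) = - chev_f K A i,
      forall i, omega (chev_f K A i) = - chev_e K A i &
      forall x, real_cartan x -> omega x = - x].

End CompactInvolution.

(* The involution is determined by its values on the generators; the following
   shows that it exists. *)
Section CompactInvolutionExists.
Variables (K : numClosedFieldType) (n : nat) (A : 'M[int]_n).
Local Notation gt := (km_tilde K A).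

Fixpoint omega_word (w : lie_word K n) : gt :=
  match w with
  | WZero => 0
  | WAdd x y => omega_word x + omega_word y
  | WScale c x => c^* *: omega_word x
  | WLie x y => lie (omega_word x) (omega_word y)
  | WE i => - tproj A (WF K i)
  | WF i => - tproj A (WE K i)
  | WH i => - tproj A (WH K i)
  end.

Let tlieN (x y : gt) : lie (- x) (- y) = lie x y.
Proof. by rewrite -[- x]scaleN1r -[- y]scaleN1r lieZl lieZr scalerA mulrNN mulr1 scale1r. Qed.

Let tlieC (x y : gt) : lie x y = - lie y x.
Proof.
apply/eqP; rewrite -addr_eq0; apply/eqP.
by have := liexx (x + y); rewrite lieDl !lieDr !liexx add0r addr0.
Qed.

Let conj_int (m : int) : (m%:~R : K)^* = m%:~R.
Proof. by rewrite rmorph_int. Qed.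

Lemma omega_word_compat x y :
  chevalley_eq A x y -> omega_word x = omega_word y.
Proof.
elim=> //=.
- by move=> *; congruence.
- by move=> x1 x2 y1 y2 _ -> _ ->.
- by move=> c x1 x2 _ ->.
- by move=> x1 x2 y1 y2 _ -> _ ->.
- by move=> *; rewrite addrA.
- by move=> *; rewrite addrC.
- by move=> *; rewrite add0r.
- by move=> *; rewrite conjC0 scale0r.
- by move=> *; rewrite conjC1 scale1r.
- by move=> *; rewrite rmorphM scalerA.
- by move=> *; rewrite scalerDr.
- by move=> *; rewrite rmorphD scalerDl.
- by move=> *; rewrite lieDl.
- by move=> *; rewrite lieDr.
- by move=> *; rewrite lieZl.
- by move=> *; rewrite lieZr.
- by move=> *; rewrite liexx.
- by move=> *; rewrite lie_jacobi.
- by move=> i j; rewrite tlieN -tproj_lie; apply/tprojP/ceq_HH.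
- move=> i; rewrite tlieN tlieC -tproj_lie; congr (- _).
  exact/tprojP/ceq_EF.
- move=> i j ij; rewrite tlieN tlieC -tproj_lie.
  have -> : tproj A (WLie (WE K j) (WF K i)) = 0.
    by apply/tprojP/ceq_EF0; rewrite eq_sym.
  by rewrite oppr0.
- move=> i j; rewrite tlieN -tproj_lie [_^*]conj_int scalerN -scaleNr -tprojZ.
  exact/tprojP/ceq_HF.
- move=> i j; rewrite tlieN -tproj_lie rmorphN /= [_^*]conj_int scaleNr scalerN opprK.
  by rewrite -tprojZ; exact/tprojP/ceq_HE.
Qed.

Definition omega_tilde (u : gt) : gt := omega_word (trepr u).

Lemma omega_tildeE w : omega_tilde (tproj A w) = omega_word w.
Proof. by apply: omega_word_compat; apply/tprojP; rewrite treprK. Qed.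

Let tsurj (P : gt -> Prop) : (forall x, P (tproj A x)) -> forall u, P u.
Proof. by move=> Px u; rewrite -[u]treprK. Qed.

Lemma omega_tildeD u v : omega_tilde (u + v) = omega_tilde u + omega_tilde v.
Proof.
by elim/tsurj: u => ?; elim/tsurj: v => ?; rewrite -tprojD !omega_tildeE.
Qed.

Lemma omega_tildeZ c u : omega_tilde (c *: u) = c^* *: omega_tilde u.
Proof. by elim/tsurj: u => ?; rewrite -tprojZ !omega_tildeE. Qed.

Lemma omega_tilde_lie u v :
  omega_tilde (lie u v) = lie (omega_tilde u) (omega_tilde v).
Proof.
by elim/tsurj: u => ?; elim/tsurj: v => ?; rewrite -tproj_lie !omega_tildeE.
Qed.

Lemma omega_tilde0 : omega_tilde 0 = 0.
Proof. by have := omega_tildeZ 0 0; rewrite conjC0 !scale0r. Qed.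

Lemma omega_tildeN u : omega_tilde (- u) = - omega_tilde u.
Proof. by apply/eqP; rewrite -addr_eq0 -omega_tildeD addNr omega_tilde0. Qed.

Lemma omega_tilde_sum (I : finType) (F : I -> gt) :
  omega_tilde (\sum_i F i) = \sum_i omega_tilde (F i).
Proof. exact: (big_morph _ omega_tildeD omega_tilde0). Qed.

Lemma omega_tildeK : involutive omega_tilde.
Proof.
elim/tsurj; elim=> [|x IHx y IHy|c x IHx|x IHx y IHy|i|i|i].
- by rewrite !(omega_tilde0, omega_tildeE).
- by rewrite tprojD !omega_tildeD IHx IHy.
- by rewrite tprojZ !omega_tildeZ IHx conjCK.
- by rewrite tproj_lie !omega_tilde_lie IHx IHy.
- by rewrite omega_tildeE /= omega_tildeN omega_tildeE opprK.
- by rewrite omega_tildeE /= omega_tildeN omega_tildeE opprK.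
- by rewrite omega_tildeE /= omega_tildeN omega_tildeE opprK.
Qed.

Lemma omega_tilde_preim_ideal (I : set gt) :
  is_ideal I -> is_ideal (omega_tilde @^-1` I).
Proof.
case=> -[I0 ID IZ] Ilie; split; first split.
- by rewrite /preimage /= omega_tilde0.
- by move=> x y Ix Iy; rewrite /preimage /= omega_tildeD; apply: ID.
- by move=> c x Ix; rewrite /preimage /= omega_tildeZ; apply: IZ.
- by move=> x y Iy; rewrite /preimage /= omega_tilde_lie; apply: Ilie.
Qed.

Lemma omega_tilde_radical u :
  km_radical u -> km_radical (omega_tilde u).
Proof.
move=> ru; apply: (ru (omega_tilde @^-1` @km_radical K n A)); split.
  exact/omega_tilde_preim_ideal/km_radical_ideal.
move=> x [I [idI Ih] Ix]; rewrite /preimage /=.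
apply: sub_gen_smallest; exists (omega_tilde @^-1` I); last first.
  by rewrite /preimage /= omega_tildeK.
split; first exact: omega_tilde_preim_ideal.
move=> y [Iy [c yE]] /=; rewrite -[y]omega_tildeK.
suff -> : omega_tilde y = 0 by rewrite omega_tilde0.
apply: Ih; split=> //; exists (\row_i - (c 0 i)^*).
rewrite yE omega_tilde_sum; apply: eq_bigr => i _.
by rewrite omega_tildeZ omega_tildeE /= mxE scalerN scaleNr.
Qed.

Local Notation pr := (lie_proj (@km_radical_ideal K n A)).

Definition omega_km (x : kac_moody K A) : kac_moody K A :=
  pr (omega_tilde (lie_repr x)).

Lemma omega_kmE u : omega_km (pr u) = pr (omega_tilde u).
Proof.
apply/lie_projP; rewrite -omega_tildeN -omega_tildeD.
apply: omega_tilde_radical.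
by apply/(lie_projP (@km_radical_ideal K n A)); rewrite lie_reprK.
Qed.

Let surj (P : kac_moody K A -> Prop) : (forall x, P (pr x)) -> forall u, P u.
Proof. by move=> Px u; rewrite -[u](lie_reprK (idI := @km_radical_ideal K n A)). Qed.

Lemma omega_kmD x y : omega_km (x + y) = omega_km x + omega_km y.
Proof.
elim/surj: x => ?; elim/surj: y => ?.
by rewrite -[_ + _]lie_projD !omega_kmE omega_tildeD lie_projD.
Qed.

Lemma omega_kmZ c x : omega_km (c *: x) = c^* *: omega_km x.
Proof.
elim/surj: x => ?.
by rewrite -[_ *: _]lie_projZ !omega_kmE omega_tildeZ lie_projZ.
Qed.

Lemma omega_km_lie x y : omega_km (lie x y) = lie (omega_km x) (omega_km y).
Proof.
elim/surj: x => ?; elim/surj: y => ?.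
by rewrite -[lie _ _]lie_proj_lie !omega_kmE omega_tilde_lie lie_proj_lie.
Qed.

Let prN u : pr (- u) = - pr u.
Proof. by rewrite -scaleN1r lie_projZ scaleN1r. Qed.

Lemma compact_involution_exists :
  exists omega : kac_moody K A -> kac_moody K A, is_compact_involution omega.
Proof.
have om0 : omega_km 0 = 0 by have := omega_kmZ 0 0; rewrite conjC0 !scale0r.
exists omega_km; split; first split.
- exists omega_km; elim/surj => u; by rewrite !omega_kmE omega_tildeK.
- exact: omega_kmD.
- exact: omega_kmZ.
- exact: omega_km_lie.
- by move=> i; rewrite [LHS]omega_kmE omega_tildeE prN.
- by move=> i; rewrite [LHS]omega_kmE omega_tildeE prN.
- move=> x [c creal ->]; rewrite /cartan_elt (big_morph _ omega_kmD om0) -sumrN.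
  apply: eq_bigr => i _; rewrite omega_kmZ (CrealP (creal i)).
  by rewrite [omega_km _]omega_kmE omega_tildeE prN scalerN.
Qed.

End CompactInvolutionExists.

Definition rank2_cartan (a : int) : 'M[int]_2 :=
  \matrix_(i, j) if i == j then 2 else - a.

Fixpoint Fseq (a : int) (k : nat) : int :=
  match k with
  | 0 => 0
  | k1.+1 => match k1 with
             | 0 => 1
             | k2.+1 => a * Fseq a k1 - Fseq a k2
             end
  end.

Definition root2 (p q : int) : 'rV[int]_2 :=
  p *: simple_root 0 + q *: simple_root 1.

(* Main.v *)
Require Import Defs.
From mathcomp Require Import all_boot all_order all_algebra.
From mathcomp Require Import boolp classical_sets reals complex.
From mathcomp Require Import zify ring.

(* Write weights as pairs (p, q) for p alpha_0 + q alpha_1.  Since det A <> 0,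
   weight vectors of distinct weights are independent, so a nilpotent X in the
   span of the real root vectors with [H, X] = 2 X is supported on positive real
   roots beta with beta(H) = 2.  For H dominant, beta(H) is strictly increasing
   along each of the two families (F_(k+1), F_k) and (F_k, F_(k+1)), so X has at
   most one component in each; comparing coordinates, dominance of the H with
   beta_0(H) = beta_1(H) = 2 amounts to F_i <= F_(j+1) and F_j <= F_(i+1).

   It remains to exclude X in a single real root space g_beta.  There
   beta([X, omega_0 X]) <= 0: this is clear for beta simple, and it is
   transported along simple reflections, because the alpha_i-string through a
   real root beta with <h_i, beta> > 0 ends at beta (the form
   p^2 + q^2 - a p q is 1 at real roots, at most 1 at positive roots, and exceeds
   1 at beta + alpha_i), and for a highest weight vector x of weight m and a
   lowest weight vector y of weight -m, [f^m x, e^m y] is, up to sign, a positive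
   multiple of the reflection of [x, y].  The bound on the form follows from the
   Serre relations and sl_2-theory. *)

Set Implicit Arguments.
Unset Strict Implicit.
Unset Printing Implicit Defensive.

Import Order.TTheory GRing.Theory Num.Theory.
Local Open Scope ring_scope.

(** * Lie algebras, eigenvectors and sl_2-strings *)

Section LieAlgebraFacts.
Variables (K : fieldType) (L : lieAlgType K).
Implicit Types (x y z : L) (U : set L).

Lemma lieC x y : lie x y = - lie y x.
Proof.
apply/eqP; rewrite -addr_eq0; apply/eqP.
by have := liexx (x + y); rewrite lieDl !lieDr !liexx add0r addr0.
Qed.

Lemma lie0r x : lie x 0 = 0.
Proof. by have := lieZr 0 x 0; rewrite !scale0r. Qed.

Lemma lie0l x : lie 0 x = 0.
Proof. by rewrite lieC lie0r oppr0. Qed.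

Lemma lieNr x y : lie x (- y) = - lie x y.
Proof. by rewrite -scaleN1r lieZr scaleN1r. Qed.

Lemma lieNl x y : lie (- x) y = - lie x y.
Proof. by rewrite -scaleN1r lieZl scaleN1r. Qed.

Lemma lieBr x y z : lie x (y - z) = lie x y - lie x z.
Proof. by rewrite lieDr lieNr. Qed.

Lemma lie_leibniz x y z : lie x (lie y z) = lie (lie x y) z + lie y (lie x z).
Proof.
have /eqP := lie_jacobi x y z.
rewrite -addrA addr_eq0 => /eqP ->.
by rewrite opprD (lieC z x) lieNr opprK -(lieC (lie x y)) addrC.
Qed.

Lemma subspace0 U : is_subspace U -> U 0.
Proof. by case. Qed.

Lemma subspaceD U x y : is_subspace U -> U x -> U y -> U (x + y).
Proof. by case=> _ + _; apply. Qed.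

Lemma subspaceZ U c x : is_subspace U -> U x -> U (c *: x).
Proof. by case=> _ _; apply. Qed.

Lemma subspaceN U x : is_subspace U -> U x -> U (- x).
Proof. by move=> sU Ux; rewrite -scaleN1r; apply: subspaceZ. Qed.

Lemma lin_span_subspace (S : set L) : is_subspace (lin_span S).
Proof.
split=> [U [[]]|x y Ux Uy U SU|c x Ux U SU] //.
  by apply: subspaceD (Ux U SU) (Uy U SU); case: SU.
by apply: subspaceZ (Ux U SU); case: SU.
Qed.

Lemma lin_span_ind (S U : set L) : is_subspace U ->
  (forall x, S x -> U x) -> forall x, lin_span S x -> U x.
Proof. by move=> sU SU x; apply; split. Qed.

Lemma lin_span_gen (S : set L) x : S x -> lin_span S x.
Proof. by move=> Sx U [_ SU]; apply: SU. Qed.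

Lemma lin_spanS (S T : set L) : (forall x, S x -> T x) ->
  forall x, lin_span S x -> lin_span T x.
Proof.
move=> ST; apply: lin_span_ind; first exact: lin_span_subspace.
by move=> x Sx; apply: lin_span_gen; apply: ST.
Qed.

(** Spanned by the iterated brackets [[e_1, [e_2, ... [e_k, s]]]]. It serves both for the ideal
    generated by a Serre element and, with [S] equal to [E], for the subalgebra generated by [E]. *)
Inductive ad_closure (E S : set L) : L -> Prop :=
| adc_gen x : S x -> ad_closure E S x
| adc_zero : ad_closure E S 0
| adc_add x y : ad_closure E S x -> ad_closure E S y -> ad_closure E S (x + y)
| adc_scale c x : ad_closure E S x -> ad_closure E S (c *: x)
| adc_ad e x : E e -> ad_closure E S x -> ad_closure E S (lie e x).

Lemma ad_closure_subspace (E S : set L) : is_subspace (ad_closure E S).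
Proof. by split; [exact: adc_zero | exact: adc_add | exact: adc_scale]. Qed.

Lemma ad_closure_ind_sub (E S U : set L) : is_subspace U ->
  (forall x, S x -> U x) -> (forall e x, E e -> U x -> U (lie e x)) ->
  forall x, ad_closure E S x -> U x.
Proof.
move=> [U0 UD UZ] SU EU x; elim=> {x}; [exact: SU|exact: U0| | |].
- by move=> x y _ Ux _ Uy; apply: UD.
- by move=> c x _ Ux; apply: UZ.
- by move=> e x Ee _ Ux; apply: EU.
Qed.

End LieAlgebraFacts.

Section EigenvectorSpan.
Variables (K : fieldType) (L : lieAlgType K) (h : L).
Implicit Types (x y : L) (S : set K) (s : seq K).

Definition eig_span S := lin_span [set x : L | exists2 l, S l & lie h x = l *: x].

Lemma eig_span_subspace S : is_subspace (eig_span S).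
Proof. exact: lin_span_subspace. Qed.

(** The product of the operators [ad h - l], for [l] in [s], applied to [x]. Each element of a span
    of eigenvectors is killed by such a product. *)
Let annih s x := foldr (fun l y => lie h y - l *: y) x s.

Let annihD s x y : annih s (x + y) = annih s x + annih s y.
Proof. by elim: s => //= l s ->; rewrite lieDr scalerDr opprD addrACA. Qed.

Let annihZ s c x : annih s (c *: x) = c *: annih s x.
Proof. by elim: s => //= l s ->; rewrite lieZr scalerBr !scalerA (mulrC l). Qed.

Let annih_lie s x : annih s (lie h x) = lie h (annih s x).
Proof. by elim: s => //= l s ->; rewrite lieBr lieZr. Qed.

Let annih0 s : annih s 0 = 0.
Proof. by have := annihZ s 0 0; rewrite !scale0r. Qed.

Let annihC s1 s2 x : annih s1 (annih s2 x) = annih s2 (annih s1 x).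
Proof.
elim: s1 => //= l s ->.
by rewrite -!scaleNr annihD annihZ annih_lie.
Qed.

Let annih_eig s l x : lie h x = l *: x ->
  annih s x = (\prod_(m <- s) (l - m)) *: x.
Proof.
move=> hx; elim: s => [|m s IH] /=; first by rewrite big_nil scale1r.
by rewrite IH big_cons lieZr hx !scalerA -scalerBl mulrBl (mulrC l).
Qed.

Let eig_span_annih S x : eig_span S x ->
  exists2 s, (forall l, l \in s -> S l) & annih s x = 0.
Proof.
move: x; apply: lin_span_ind.
- split; first by exists [::].
  + move=> x y [s1 S1 s1x] [s2 S2 s2y]; exists (s1 ++ s2).
      by move=> l; rewrite mem_cat => /orP[/S1|/S2].
    rewrite /annih foldr_cat -/(annih s2 _) -/(annih s1 _) annihD s2y addr0.
    by rewrite annihC s1x annih0.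
  + by move=> c x [s Ss sx]; exists s => //; rewrite annihZ sx scaler0.
- move=> x [l Sl hx]; exists [:: l]; first by move=> m; rewrite inE => /eqP ->.
  by rewrite /= hx subrr.
Qed.

Let eig_span_inj S l x : eig_span S x -> ~ S l -> lie h x = l *: x -> x = 0.
Proof.
move=> /eig_span_annih[s Ss sx] Sl hx; move: sx; rewrite (annih_eig _ hx).
move=> /eqP; rewrite scaler_eq0 => /orP[|/eqP //].
rewrite prodf_seq_eq0 => /hasP[m ms]; rewrite /= subr_eq0 => /eqP lm.
by case: Sl; rewrite lm; apply: Ss.
Qed.

Let eig_span_annih_stable S s x : eig_span S x -> eig_span S (annih s x).
Proof.
move: x; apply: lin_span_ind.
  split; first by rewrite annih0; exact: subspace0 (eig_span_subspace S).
    by move=> y z Sy Sz; rewrite annihD; exact: subspaceD (eig_span_subspace S) _ _.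
  by move=> c y Sy; rewrite annihZ; exact: subspaceZ (eig_span_subspace S) _.
move=> x [l Sl hx]; rewrite (annih_eig _ hx).
by apply: (subspaceZ _ (eig_span_subspace S)); apply: lin_span_gen; exists l.
Qed.

(** A product of factors [ad h - l] with [l] in [S1] kills [x], and each factor is injective on
    [eig_span S2], so the factors can be stripped off one at a time. *)
Lemma eig_span_disjoint S1 S2 x : (forall l, S1 l -> ~ S2 l) ->
  eig_span S1 x -> eig_span S2 x -> x = 0.
Proof.
move=> dis /eig_span_annih[s Ss sx] S2x; elim: s Ss sx => [|l s IH] //= Ss /eqP.
rewrite subr_eq0 => /eqP lx; apply: IH => [m ms|].
  by apply: Ss; rewrite inE ms orbT.
apply: (eig_span_inj (eig_span_annih_stable s S2x) _ lx).
by apply/dis/Ss; rewrite inE eqxx.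
Qed.

End EigenvectorSpan.

Section SL2.
Variables (K : numFieldType) (L : lieAlgType K) (e f h : L).
Hypotheses (hef : lie e f = h) (hhe : lie h e = 2 *: e) (hhf : lie h f = - 2 *: f).
Implicit Types (x y z t : L) (c : K).

Let scalerC c1 c2 x : c1 *: (c2 *: x) = c2 *: (c1 *: x).
Proof. by rewrite !scalerA mulrC. Qed.

Lemma sl2_flip : [/\ lie f e = - h, lie (- h) f = 2 *: f & lie (- h) e = - 2 *: e].
Proof. by rewrite lieC hef !lieNl hhe hhf !scaleNr opprK. Qed.

Lemma sl2_weight_iter c z k : lie h z = c *: z ->
  lie h (iter k (lie f) z) = (c - k%:R *+ 2) *: iter k (lie f) z.
Proof.
move=> hz; elim: k => [|k IH] /=; first by rewrite mul0rn subr0.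
rewrite lie_leibniz hhf IH lieZl lieZr -scalerDl; congr (_ *: _).
by rewrite -(natr1 k); ring.
Qed.

Lemma sl2_lie_iter c z k : lie h z = c *: z ->
  lie e (iter k.+1 (lie f) z) =
    iter k.+1 (lie f) (lie e z) + (k.+1%:R * (c - k%:R)) *: iter k (lie f) z.
Proof.
move=> hz; elim: k => [|k IH].
  by rewrite /= lie_leibniz hef hz mul1r subr0 addrC.
rewrite iterS lie_leibniz IH hef (sl2_weight_iter _ hz) lieDr lieZr !iterS.
rewrite addrCA -scalerDl; congr (_ + _ *: _).
by rewrite -(natr1 k.+1) -(natr1 k); ring.
Qed.

Lemma iter_lie0 x k : iter k (lie x) 0 = 0.
Proof. by elim: k => //= k ->; rewrite lie0r. Qed.

(** Applying [e] to [f^(k+1) z = 0] gives [(k+1) (m-k) f^k z = 0], with a nonzero coefficient for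
    [k < m]; this descends from [f^m z] to [z]. *)
Lemma sl2_highest_inj (m : nat) z : lie h z = m%:R *: z -> lie e z = 0 ->
  iter m (lie f) z = 0 -> z = 0.
Proof.
move=> hz ez; have : (m <= m)%N by []; elim: {1 3}m => //= k IH km fz.
apply: IH; first exact: ltnW.
have := sl2_lie_iter k hz; rewrite iterS fz lie0r ez iter_lie0 add0r.
move=> /esym/eqP; rewrite scaler_eq0 mulf_eq0 pnatr_eq0 /= subr_eq0 eqr_nat.
by rewrite (gtn_eqF km) => /eqP.
Qed.

(** Nilpotency of [e] on [z] replaces the highest weight assumption. If [f^m z = 0], the commutation
    formula makes [f^m (e z)] a multiple of [f^(m-1) z], so [f^(m+2)] kills [e z], which has weight
    [m + 2] and vanishes by induction on [N]. *)
Lemma sl2_iter_inj (N m : nat) z : lie h z = m%:R *: z ->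
  iter N (lie e) z = 0 -> iter m (lie f) z = 0 -> z = 0.
Proof.
elim: N m z => [|N IH] m z hz //; rewrite iterSr => Nz fz.
suff ez : lie e z = 0 by apply: sl2_highest_inj fz.
apply: (IH m.+2) => //.
  by rewrite lie_leibniz hhe hz lieZl lieZr -scalerDl -!(natr1 _); congr (_ *: _); ring.
case: m hz fz => [|m] hz fz; first by rewrite [z]fz lie0r iter_lie0.
have := sl2_lie_iter m hz; rewrite fz lie0r => /esym/eqP.
rewrite addr_eq0 => /eqP fez.
by rewrite 2!iterS fez lieNr lieZr -(iterS _ (lie f)) fz scaler0 oppr0 lie0r.
Qed.

(* With [v j k = [f^j x, e^k y]], invariance under [ad e] gives
   [v (j+1) (k+1) = [e, v (j+1) k] - (j+1)(m-j) v j k]; solving this recursion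
   at [j = k = m] produces the reflection [t - alpha(t) h] up to a factor. *)
Lemma sl2_pairing (m : nat) c x y t :
  (0 < m)%N -> lie e x = 0 -> lie h x = m%:R *: x -> lie f y = 0 ->
  lie x y = t -> lie f t = c *: f ->
  lie (iter m (lie f) x) (iter m (lie e) y) =
    ((-1) ^+ m * (\prod_(l < m) (l.+1 * (m - l))%N)%:R) *: (t - c *: h).
Proof.
move=> m0 ex hx fy xy ft.
pose A k : K := \prod_(l < k) - (l.+1%:R * (m%:R - l%:R)).
pose v j k := lie (iter j (lie f) x) (iter k (lie e) y).
have AS k : A k.+1 = - (k.+1%:R * (m%:R - k%:R)) * A k.
  by rewrite /A big_ord_recr /= mulrC.
have vS j k : v j.+1 k.+1 = lie e (v j.+1 k) - (j.+1%:R * (m%:R - j%:R)) *: v j k.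
  rewrite /v [lie e (lie _ _)]lie_leibniz (sl2_lie_iter _ hx) ex iter_lie0 add0r.
  by rewrite lieZl addrAC subrr add0r.
(* Below the diagonal the recursion closes: [v j 0 = f^j t] vanishes for [j >= 2], as [[f, t]] is a
   multiple of [f]. The factor [m] clears the denominator in [v k k = A k (t - (k / m) c h)]. *)
have main k : [/\ forall j, (k.+1 < j)%N -> v j k = 0,
     m%:R *: v k.+1 k = (- A k.+1 * c) *: f &
     m%:R *: v k k = A k *: (m%:R *: t - (k%:R * c) *: h)].
  elim: k => [|k [IH0 IH1 IH2]].
    have vj0 j : v j 0 = iter j (lie f) t.
      elim: j => [//|j IH]; rewrite /v /= -IH [RHS]lie_leibniz fy lie0r.
      by rewrite addr0.
    split.
    - case=> [//|[//|j _]].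
      by rewrite vj0 !iterSr ft lieZr liexx scaler0 iter_lie0.
    - rewrite vj0 /= ft scalerA AS /A big_ord0; congr (_ *: _); ring.
    - by rewrite vj0 /A big_ord0 mul0r scale0r subr0 scale1r.
  split.
  - by case=> [//|j] kj; rewrite vS !IH0 ?lie0r ?scaler0 ?subrr //; exact: ltnW.
  - rewrite vS IH0 // lie0r sub0r scalerN scalerC IH1 scalerA.
    by rewrite -scaleNr (AS k.+1); congr (_ *: _); ring.
  - rewrite vS scalerBr -lieZr IH1 lieZr hef scalerC IH2 -scaleNr scalerA -AS.
    rewrite !scalerBr !scalerA addrCA; congr (_ + _).
    by rewrite -scaleNr -scalerDl -scaleNr; congr (_ *: h); rewrite -(natr1 k); ring.
have [_ _ vm] := main m.
have mN0 : (m%:R : K) != 0 by rewrite pnatr_eq0 -lt0n.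
apply: (scalerI mN0); rewrite -/(v m m) vm.
rewrite [RHS]scalerC; congr (_ *: _); last by rewrite scalerBr scalerA.
rewrite /A prodrN card_ord natr_prod; congr (_ * _).
by apply: eq_bigr => l _; rewrite natrM natrB // ltnW.
Qed.

End SL2.

(** * Chevalley generators in rank 2 *)

(* The generation axiom is phrased so that it holds both in g~(A) and in its
   quotient g(A). *)
Record chevalley2 (K : numClosedFieldType) (L : lieAlgType K) (a : int)
    (e0 e1 f0 f1 h0 h1 : L) : Prop := {
  cv_ge3 : 3 <= a;
  cv_hh : lie h0 h1 = 0;
  cv_e0f0 : lie e0 f0 = h0;
  cv_e1f1 : lie e1 f1 = h1;
  cv_e0f1 : lie e0 f1 = 0;
  cv_e1f0 : lie e1 f0 = 0;
  cv_h0e0 : lie h0 e0 = 2 *: e0;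
  cv_h0e1 : lie h0 e1 = - a%:~R *: e1;
  cv_h1e0 : lie h1 e0 = - a%:~R *: e0;
  cv_h1e1 : lie h1 e1 = 2 *: e1;
  cv_h0f0 : lie h0 f0 = - 2 *: f0;
  cv_h0f1 : lie h0 f1 = a%:~R *: f1;
  cv_h1f0 : lie h1 f0 = a%:~R *: f0;
  cv_h1f1 : lie h1 f1 = - 2 *: f1;
  cv_gen : forall U : set L, is_subspace U ->
    (forall y, U y -> [/\ U (lie e0 y), U (lie e1 y), U (lie f0 y) & U (lie f1 y)]) ->
    forall x y, U y -> U (lie x y)
}.

Section Symmetries.
Variables (K : numClosedFieldType) (L : lieAlgType K) (a : int).
Variables (e0 e1 f0 f1 h0 h1 : L).
Hypothesis cv : chevalley2 a e0 e1 f0 f1 h0 h1.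

Lemma chevalley2_swap : chevalley2 a e1 e0 f1 f0 h1 h0.
Proof.
case: cv => *; split => //; first by rewrite lieC; apply/eqP; rewrite oppr_eq0; apply/eqP.
by move=> U sU stab; apply: (cv_gen cv) => // z /stab[].
Qed.

(** Together with [chevalley2_swap] this plays the role of the Chevalley involution, with no map of
    [L] to construct: an argument for [e0] applies to [e1], [f0] and [f1]. *)
Lemma chevalley2_flip : chevalley2 a f0 f1 e0 e1 (- h0) (- h1).
Proof.
case: (cv) => ? hh e0f0 e1f1 e0f1 e1f0 *; split; rewrite ?lieNl ?lieNr => //.
- by rewrite hh !oppr0.
- by rewrite lieC e0f0.
- by rewrite lieC e1f1.
- by rewrite lieC e1f0 oppr0.
- by rewrite lieC e0f1 oppr0.
- by rewrite (cv_h0f0 cv) scaleNr opprK.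
- by rewrite (cv_h0f1 cv) scaleNr.
- by rewrite (cv_h1f0 cv) scaleNr.
- by rewrite (cv_h1f1 cv) scaleNr opprK.
- by rewrite (cv_h0e0 cv) scaleNr.
- by rewrite (cv_h0e1 cv) scaleNr opprK.
- by rewrite (cv_h1e0 cv) scaleNr opprK.
- by rewrite (cv_h1e1 cv) scaleNr.
- by move=> U sU stab; apply: (cv_gen cv) => // z /stab[].
Qed.

End Symmetries.

Section Weights.
Variables (K : numClosedFieldType) (L : lieAlgType K) (a : int) (h0 h1 : L).
Implicit Types (x y : L) (p q : int) (W : int -> int -> Prop).

Definition wt p q x :=
  lie h0 x = (2 * p - a * q)%:~R *: x /\ lie h1 x = (2 * q - a * p)%:~R *: x.

Definition wt_span W := lin_span [set x : L | exists p q, W p q /\ wt p q x].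

Lemma wt_span_subspace W : is_subspace (wt_span W).
Proof. exact: lin_span_subspace. Qed.

Lemma wt_span_gen W p q x : W p q -> wt p q x -> wt_span W x.
Proof. by move=> Wpq xpq; apply: lin_span_gen; exists p, q. Qed.

Lemma wt_spanS W W' x : (forall p q, W p q -> W' p q) ->
  wt_span W x -> wt_span W' x.
Proof.
move=> WW'; apply: lin_spanS => y [p [q [Wpq ypq]]].
by exists p, q; split=> //; apply: WW'.
Qed.

Lemma wt_subspace p q : is_subspace (wt p q).
Proof.
split; first by rewrite /wt !lie0r !scaler0.
  by move=> x y [x0 x1] [y0 y1]; rewrite /wt !lieDr !scalerDr x0 x1 y0 y1.
by move=> c x [x0 x1]; rewrite /wt !lieZr x0 x1 !scalerA ![c * _]mulrC.
Qed.

Lemma wt_lie p q r s x y : wt p q x -> wt r s y -> wt (p + r) (q + s) (lie x y).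
Proof.
move=> [x0 x1] [y0 y1]; rewrite /wt !(lie_leibniz _ x y) x0 x1 y0 y1.
by rewrite !lieZl !lieZr -!scalerDl -!intrD; split; congr (_%:~R *: _); ring.
Qed.

Lemma wt_span_lie W W' p q x y : wt p q x ->
  (forall r s, W r s -> W' (p + r) (q + s)) -> wt_span W y -> wt_span W' (lie x y).
Proof.
move=> xpq WW'; move: y; apply: lin_span_ind.
  have sW := wt_span_subspace W'.
  split; first by rewrite lie0r; exact: subspace0 sW.
    by move=> y z Wy Wz; rewrite lieDr; exact: subspaceD sW _ _.
  by move=> c y Wy; rewrite lieZr; exact: subspaceZ sW _.
move=> y [r [s [Wrs yrs]]]; apply: wt_span_gen (wt_lie xpq yrs); exact: WW'.
Qed.

Lemma wt_iter p q r s x y k : wt p q x -> wt r s y ->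
  wt (p *+ k + r) (q *+ k + s) (iter k (lie x) y).
Proof.
move=> xpq yrs; elim: k => [|k IH] /=; first by rewrite !mulr0n !add0r.
by rewrite !mulrS -!addrA; apply: wt_lie.
Qed.

Hypothesis ha : 3 <= a.

Let int_rect_inj (u v u' v' : int) :
  u%:~R + 'i * v%:~R = u'%:~R + 'i * v'%:~R :> K -> u = u' /\ v = v'.
Proof.
have re (m : int) : (m%:~R : K) \is Num.real by exact: realz.
move=> /eqCP; rewrite !Re_rect // !Im_rect // => -[/eqP + /eqP].
by rewrite !eqr_int => /eqP -> /eqP ->.
Qed.

(* [h0 + i h1] takes distinct values at distinct weights: the real and
   imaginary parts determine the weight because [a^2 <> 4]. *)
Lemma wt_span_disjoint W1 W2 x : (forall p q, W1 p q -> ~ W2 p q) ->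
  wt_span W1 x -> wt_span W2 x -> x = 0.
Proof.
pose ev p q : K := (2 * p - a * q)%:~R + 'i * (2 * q - a * p)%:~R.
pose S W : set K := fun l => exists p q, W p q /\ l = ev p q.
have toS W y : wt_span W y -> eig_span (h0 + 'i *: h1) (S W) y.
  apply: lin_spanS => z [p [q [Wpq [z0 z1]]]]; exists (ev p q); first by exists p, q.
  by rewrite lieDl lieZl z0 z1 scalerA -scalerDl.
move=> dis /toS x1 /toS x2; apply: eig_span_disjoint x1 x2.
move=> l [p [q [W1pq ->]]] [p' [q' [W2pq /int_rect_inj[u v]]]].
suff [pp' qq'] : p = p' /\ q = q' by apply: (dis _ _ W1pq); rewrite pp' qq'.
have P : 2 * (p - p') = a * (q - q') by lia.
have Q : 2 * (q - q') = a * (p - p') by lia.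
have aN0 : a * a - 4 != 0 by apply/eqP; nia.
have /eqP : (a * a - 4) * (p - p') = 0.
  have -> : (a * a - 4) * (p - p') = a * (a * (p - p')) - 2 * (2 * (p - p')) by ring.
  by rewrite -Q P; ring.
rewrite mulf_eq0 (negbTE aN0) /= subr_eq0 => /eqP pp'; split=> //; move: Q.
by rewrite pp'; lia.
Qed.

Lemma wt_span_notin W p q x : wt_span W x -> wt p q x -> ~ W p q -> x = 0.
Proof.
move=> Wx xpq nW.
apply: (wt_span_disjoint (W1 := W) (W2 := fun r s => r = p /\ s = q)) => //.
  by move=> r s Wrs [rp sq]; apply: nW; rewrite -rp -sq.
exact: wt_span_gen xpq.
Qed.

End Weights.

Lemma wt_swap (K : numClosedFieldType) (L : lieAlgType K) a (h0 h1 : L) p q x :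
  wt a h1 h0 q p x <-> wt a h0 h1 p q x.
Proof. by split; case. Qed.

Lemma wt_flip (K : numClosedFieldType) (L : lieAlgType K) a (h0 h1 : L) p q x :
  wt a (- h0) (- h1) p q x <-> wt a h0 h1 (- p) (- q) x.
Proof.
rewrite /wt !lieNl !mulrN -!opprD !mulrNz !scaleNr; split; case=> u v; split.
- by rewrite -u opprK.
- by rewrite -v opprK.
- by rewrite u opprK.
- by rewrite v opprK.
Qed.

(** * The ideal generated by a Serre element *)

Section SerreIdeal.
Variables (K : numClosedFieldType) (L : lieAlgType K) (a : int).
Variables (e0 e1 f0 f1 h0 h1 : L).
Hypothesis cv : chevalley2 a e0 e1 f0 f1 h0 h1.
Local Notation wt := (wt a h0 h1).
Local Notation wt_span := (wt_span a h0 h1).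

Lemma wt_e0 : wt 1 0 e0.
Proof.
by split; rewrite ?(cv_h0e0 cv) ?(cv_h1e0 cv) mulr1 mulr0 ?subr0 ?sub0r ?mulrNz.
Qed.

Lemma wt_e1 : wt 0 1 e1.
Proof.
by split; rewrite ?(cv_h0e1 cv) ?(cv_h1e1 cv) mulr1 mulr0 ?subr0 ?sub0r ?mulrNz.
Qed.

Lemma wt_h0 : wt 0 0 h0.
Proof. by split; rewrite !mulr0 subr0 scale0r ?liexx // lieC (cv_hh cv) oppr0. Qed.

Lemma wt_h1 : wt 0 0 h1.
Proof. by split; rewrite !mulr0 subr0 scale0r ?liexx // (cv_hh cv). Qed.

Lemma iter_lie_comm (x y z : L) k : lie x y = 0 ->
  lie x (iter k (lie y) z) = iter k (lie y) (lie x z).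
Proof.
move=> xy; elim: k => //= k IH.
by rewrite lie_leibniz xy lie0l add0r IH.
Qed.

Let N := `|a|%N.
Let aN : a%:~R = N%:R :> K.
Proof. by rewrite pmulrn /N gez0_abs //; have := cv_ge3 cv; lia. Qed.

(** The Serre element [(ad e_0)^(1 - a_01) e_1]: here [1 - a_01 = a + 1] and [a > 0]. *)
Definition serre_elt := iter `|a|.+1 (lie e0) e1.

(** For the triple [f0, e0, -h0] the element [e1] is a highest weight vector of weight [a], and the
    coefficient [(a + 1) (a - a)] in [sl2_lie_iter] vanishes. *)
Lemma lie_f0_serre : lie f0 serre_elt = 0.
Proof.
have [fe nhf nhe] := sl2_flip (cv_e0f0 cv) (cv_h0e0 cv) (cv_h0f0 cv).
rewrite /serre_elt (sl2_lie_iter fe nhe (c := a%:~R)); last first.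
  by rewrite lieNl (cv_h0e1 cv) scaleNr opprK.
by rewrite lieC (cv_e1f0 cv) oppr0 iter_lie0 -/N aN subrr mulr0 scale0r addr0.
Qed.

(** [f1] commutes with [e0], which leaves [(ad e0)^(a+1) h1] up to sign; the first bracket gives a
    multiple of [e0] and the second kills it. *)
Lemma lie_f1_serre : lie f1 serre_elt = 0.
Proof.
rewrite /serre_elt iter_lie_comm; last by rewrite lieC (cv_e0f1 cv) oppr0.
rewrite (lieC f1) (cv_e1f1 cv) iterSr lieNr (lieC e0) opprK (cv_h1e0 cv).
have a0 : (0 < `|a|)%N by have := cv_ge3 cv; lia.
rewrite -(prednK a0).
by rewrite iterSr lieZr liexx scaler0 iter_lie0.
Qed.

Let e01 : set L := fun e => e = e0 \/ e = e1.
Let I := ad_closure e01 (fun x => x = serre_elt).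

(** By the Leibniz rule, moving [ad x] past [ad e] only costs [ad [x, e]]. For [x] equal to [f0] or
    [f1] these commutators lie in the Cartan part, so [h0] and [h1] are treated first. *)
Let I_stable (x : L) : I (lie x serre_elt) ->
  (forall e y, e01 e -> I y -> I (lie (lie x e) y)) ->
  forall y, I y -> I (lie x y).
Proof.
move=> xs xe y; elim=> {y}.
- by move=> y ->.
- by rewrite lie0r; exact: adc_zero.
- by move=> y z _ Iy _ Iz; rewrite lieDr; apply: adc_add.
- by move=> c y _ Iy; rewrite lieZr; apply: adc_scale.
- move=> e y Ee Iy Ixy; rewrite lie_leibniz; apply: adc_add; first exact: xe.
  exact: adc_ad.
Qed.

Let Is : I serre_elt. Proof. exact: adc_gen. Qed.

Let wt_serre : wt `|a|.+1%:Z 1 serre_elt.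
Proof.
have := wt_iter `|a|.+1 wt_e0 wt_e1.
by rewrite mul0rn add0r addr0 natz.
Qed.

Let I_h0 y : I y -> I (lie h0 y).
Proof.
apply: I_stable; first by case: wt_serre => -> _; apply: adc_scale.
move=> e z [->|->] Iz; rewrite ?(cv_h0e0 cv) ?(cv_h0e1 cv) lieZl;
  by apply/adc_scale/adc_ad => //; by [left|right].
Qed.

Let I_h1 y : I y -> I (lie h1 y).
Proof.
apply: I_stable; first by case: wt_serre => _ ->; apply: adc_scale.
move=> e z [->|->] Iz; rewrite ?(cv_h1e0 cv) ?(cv_h1e1 cv) lieZl;
  by apply/adc_scale/adc_ad => //; by [left|right].
Qed.

(** Brackets with [e0] and [e1] alone already span an ideal, since [f0] and [f1] kill the Serre
    element. The bound [1 <= q] excludes the weight zero, hence nonzero elements of the Cartan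
    subalgebra. *)
Lemma serre_ideal : exists J : set L, [/\ is_ideal J, J serre_elt &
  forall x, J x -> wt_span (fun p q => 1 <= q) x].
Proof.
have nI z : I z -> I (- z) by exact: subspaceN (ad_closure_subspace _ _).
exists I; split=> //.
- split; first exact: ad_closure_subspace.
  apply: (cv_gen cv); first exact: ad_closure_subspace.
  move=> y Iy; split; try by apply: adc_ad; [by [left|right]|].
  + apply: (I_stable _ _ Iy); first by rewrite lie_f0_serre; exact: adc_zero.
    move=> e z [->|->] Iz; rewrite (lieC f0) lieNl ?(cv_e0f0 cv) ?(cv_e1f0 cv).
      exact/nI/I_h0.
    by rewrite lie0l oppr0; exact: adc_zero.
  + apply: (I_stable _ _ Iy); first by rewrite lie_f1_serre; exact: adc_zero.
    move=> e z [->|->] Iz; rewrite (lieC f1) lieNl ?(cv_e1f1 cv) ?(cv_e0f1 cv).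
      by rewrite lie0l oppr0; exact: adc_zero.
    exact/nI/I_h1.
- apply: ad_closure_ind_sub; first exact: wt_span_subspace.
    by move=> x ->; exact: wt_span_gen wt_serre.
  move=> e x [->|->]; [apply: wt_span_lie wt_e0 _|apply: wt_span_lie wt_e1 _] => r s; lia.
Qed.
End SerreIdeal.

(** * Root spaces *)

(** What the analysis of roots needs from g(A), with the generators as parameters so that renaming
    them gives another instance. *)
Record serre2 (K : numClosedFieldType) (L : lieAlgType K) (a : int)
    (e0 e1 f0 f1 h0 h1 : L) : Prop := {
  se_cv : chevalley2 a e0 e1 f0 f1 h0 h1;
  se_e0 : serre_elt a e0 e1 = 0;
  se_e1 : serre_elt a e1 e0 = 0;
  se_f0 : serre_elt a f0 f1 = 0;
  se_f1 : serre_elt a f1 f0 = 0;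
  se_full : forall U : set L, is_ideal U -> U e0 -> U e1 -> U f0 -> U f1 ->
    forall x, U x
}.

Section SerreSymmetries.
Variables (K : numClosedFieldType) (L : lieAlgType K) (a : int).
Variables (e0 e1 f0 f1 h0 h1 : L).
Hypothesis se : serre2 a e0 e1 f0 f1 h0 h1.

Lemma serre2_swap : serre2 a e1 e0 f1 f0 h1 h0.
Proof.
case: se => *; split=> //; first exact: chevalley2_swap.
by move=> U *; apply: (se_full se).
Qed.

Lemma serre2_flip : serre2 a f0 f1 e0 e1 (- h0) (- h1).
Proof.
case: se => *; split=> //; first exact: chevalley2_flip.
by move=> U *; apply: (se_full se).
Qed.

End SerreSymmetries.

Section PositivePart.
Variables (K : numClosedFieldType) (L : lieAlgType K) (a : int).
Variables (e0 e1 f0 f1 h0 h1 : L).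
Hypothesis se : serre2 a e0 e1 f0 f1 h0 h1.
Let cv := se_cv se.

Definition pos_part (x y : L) : set L :=
  ad_closure (fun e => e = x \/ e = y) (fun e => e = x \/ e = y).

Let Eu : set L := fun x => exists2 k, (k <= `|a|)%N & x = iter k (lie e0) e1.
Let M := ad_closure Eu Eu.

Let M0 : M 0. Proof. exact: adc_zero. Qed.
Let Me1 : Eu e1. Proof. by exists 0. Qed.

Let M_e0 x : M x -> M (lie e0 x).
Proof.
have EuE y : Eu y -> lie e0 y = 0 \/ Eu (lie e0 y).
  move=> [k]; rewrite leq_eqVlt => /orP[/eqP -> ->|ka ->].
    by left; exact: se_e0 se.
  by right; exists k.+1.
elim=> {x}.
- by move=> x /EuE[->|] // Ex; exact: adc_gen.
- by rewrite lie0r.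
- by move=> x y _ Mx _ My; rewrite lieDr; exact: adc_add.
- by move=> c x _ Mx; rewrite lieZr; exact: adc_scale.
- move=> e x Ee Mx IH; rewrite lie_leibniz; apply: adc_add; last exact: adc_ad.
  by case: (EuE _ Ee) => [->|Ex]; [rewrite lie0l|exact: adc_ad].
Qed.

(* By the Serre relation the subalgebra generated by the [(ad e0)^k e1] with
   [k <= a] is stable under [ad e0], which bounds the weights of n^+. *)
Lemma pos_part_decomp x : pos_part e0 e1 x -> exists c z,
  x = c *: e0 + z /\ wt_span a h0 h1 (fun p q => [/\ 1 <= q, 0 <= p & p <= a * q]) z.
Proof.
have ge3 := cv_ge3 cv.
suff main : pos_part e0 e1 x -> exists c z, x = c *: e0 + z /\ M z.
  move=> /main[c [z [-> Mz]]]; exists c, z; split=> //; move: z Mz.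
  (* The generators have weights [(k, 1)] with [0 <= k <= a], and the inequalities [0 <= p <= a q]
     add up under brackets. *)
  have wE y : Eu y -> exists2 k : nat, (k <= `|a|)%N & wt a h0 h1 k%:Z 1 y.
    move=> [k ka ->]; exists k => //.
    by have := wt_iter k (wt_e0 cv) (wt_e1 cv); rewrite mul0rn add0r addr0 natz.
  apply: ad_closure_ind_sub; first exact: wt_span_subspace.
    by move=> y /wE[k ka]; apply: wt_span_gen; split; lia.
  by move=> e y /wE[k ka wy]; apply: wt_span_lie wy _ => r s [? ? ?]; split; lia.
move: x; apply: ad_closure_ind_sub.
- split; first by exists 0, 0; rewrite scale0r addr0.
    move=> x y [c [z [-> Mz]]] [d [t [-> Mt]]]; exists (c + d), (z + t).
    by rewrite scalerDl addrACA; split=> //; exact: adc_add.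
  move=> c x [d [z [-> Mz]]]; exists (c * d), (c *: z).
  by rewrite scalerDr scalerA; split=> //; exact: adc_scale.
- move=> x [->|->]; first by exists 1, 0; rewrite scale1r addr0.
  by exists 0, e1; rewrite scale0r add0r; split=> //; exact: adc_gen.
- move=> e x Ee [c [z [-> Mz]]]; exists 0, (lie e (c *: e0 + z)).
  rewrite scale0r add0r; split=> //; rewrite lieDr lieZr; apply: adc_add.
    apply: adc_scale; case: Ee => [->|->]; first by rewrite liexx.
    rewrite lieC -scaleN1r; apply/adc_scale/M_e0; exact: adc_gen.
  by case: Ee => [->|->]; [exact: M_e0|exact: adc_ad].
Qed.

End PositivePart.

(** * Triangular decomposition *)

Section Triangular.
Variables (K : numClosedFieldType) (L : lieAlgType K) (a : int).
Variables (e0 e1 f0 f1 h0 h1 : L).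
Hypothesis se : serre2 a e0 e1 f0 f1 h0 h1.
Let cv := se_cv se.

Definition cartan2 (x y : L) : set L := fun t => exists c d, t = c *: x + d *: y.

Lemma cartan2_subspace x y : is_subspace (cartan2 x y).
Proof.
split; first by exists 0, 0; rewrite !scale0r addr0.
  move=> _ _ [c [d ->]] [c' [d' ->]]; exists (c + c'), (d + d').
  by rewrite !scalerDl addrACA.
by move=> b _ [c [d ->]]; exists (b * c), (b * d); rewrite scalerDr !scalerA.
Qed.

Definition triangular (x : L) := exists u t v,
  [/\ pos_part e0 e1 u, cartan2 h0 h1 t, pos_part f0 f1 v & x = u + t + v].

Let Lm_sub : is_subspace (pos_part f0 f1). Proof. exact: ad_closure_subspace. Qed.
Let Lp_sub : is_subspace (pos_part e0 e1). Proof. exact: ad_closure_subspace. Qed.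
Let h_sub : is_subspace (cartan2 h0 h1). Proof. exact: cartan2_subspace. Qed.

Lemma triangular_subspace : is_subspace triangular.
Proof.
split.
- by exists 0, 0, 0; split; rewrite ?addr0 //; exact: subspace0.
- move=> _ _ [u [t [v [Lu ht Lv ->]]]] [u' [t' [v' [Lu' ht' Lv' ->]]]].
  exists (u + u'), (t + t'), (v + v'); split; try exact: subspaceD.
  by rewrite addrACA [X in X + _]addrACA.
- move=> c _ [u [t [v [Lu ht Lv ->]]]]; exists (c *: u), (c *: t), (c *: v).
  by split; rewrite ?scalerDr //; exact: subspaceZ.
Qed.

Let tri_p u : pos_part e0 e1 u -> triangular u.
Proof. by move=> Lu; exists u, 0, 0; split; rewrite ?addr0 //; exact: subspace0. Qed.
Let tri_h t : cartan2 h0 h1 t -> triangular t.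
Proof. by move=> ht; exists 0, t, 0; split; rewrite ?addr0 ?add0r //; exact: subspace0. Qed.
Let tri_m v : pos_part f0 f1 v -> triangular v.
Proof. by move=> Lv; exists 0, 0, v; split; rewrite ?add0r //; exact: subspace0. Qed.

Let ch0 : cartan2 h0 h1 h0. Proof. by exists 1, 0; rewrite scale1r scale0r addr0. Qed.
Let ch1 : cartan2 h0 h1 h1. Proof. by exists 0, 1; rewrite scale1r scale0r add0r. Qed.

Let isf (f : L) := f = f0 \/ f = f1.
Let ise (e : L) := e = e0 \/ e = e1.

Let lie_hf t f : cartan2 h0 h1 t -> isf f -> exists c, lie t f = c *: f.
Proof.
move=> [c [d ->]] [->|->]; rewrite lieDl !lieZl.
  by rewrite (cv_h0f0 cv) (cv_h1f0 cv) !scalerA -scalerDl; eexists.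
by rewrite (cv_h0f1 cv) (cv_h1f1 cv) !scalerA -scalerDl; eexists.
Qed.

Let lie_he t e : cartan2 h0 h1 t -> ise e -> exists c, lie t e = c *: e.
Proof.
move=> [c [d ->]] [->|->]; rewrite lieDl !lieZl.
  by rewrite (cv_h0e0 cv) (cv_h1e0 cv) !scalerA -scalerDl; eexists.
by rewrite (cv_h0e1 cv) (cv_h1e1 cv) !scalerA -scalerDl; eexists.
Qed.

Let lie_ef e f : ise e -> isf f -> cartan2 h0 h1 (lie e f).
Proof.
move=> [->|->] [->|->].
- by rewrite (cv_e0f0 cv).
- by rewrite (cv_e0f1 cv); exact: subspace0.
- by rewrite (cv_e1f0 cv); exact: subspace0.
- by rewrite (cv_e1f1 cv).
Qed.

Let lie_hm t v : cartan2 h0 h1 t -> pos_part f0 f1 v -> pos_part f0 f1 (lie t v).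
Proof.
move=> ht; elim=> {v}.
- by move=> f ff; have [c ->] := lie_hf ht ff; apply/adc_scale/adc_gen.
- by rewrite lie0r; exact: subspace0.
- by move=> *; rewrite lieDr; exact: adc_add.
- by move=> *; rewrite lieZr; exact: adc_scale.
- move=> f v ff Lv IH; rewrite lie_leibniz; apply: adc_add; last exact: adc_ad.
  by have [c ->] := lie_hf ht ff; rewrite lieZl; apply/adc_scale/adc_ad.
Qed.

Let lower x := exists t v, [/\ cartan2 h0 h1 t, pos_part f0 f1 v & x = t + v].

Let lower_sub : is_subspace lower.
Proof.
split.
- by exists 0, 0; split; rewrite ?addr0 //; exact: subspace0.
- move=> _ _ [t [v [ht Lv ->]]] [t' [v' [ht' Lv' ->]]].
  exists (t + t'), (v + v'); split; try exact: subspaceD.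
  by rewrite addrACA.
- move=> c _ [t [v [ht Lv ->]]]; exists (c *: t), (c *: v).
  by split; rewrite ?scalerDr //; exact: subspaceZ.
Qed.

Let lie_em e v : ise e -> pos_part f0 f1 v -> lower (lie e v).
Proof.
move=> ee; elim=> {v}.
- move=> f ff; exists (lie e f), 0; split; rewrite ?addr0 //; last exact: subspace0.
  exact: lie_ef.
- by rewrite lie0r; exact: subspace0.
- by move=> *; rewrite lieDr; exact: subspaceD.
- by move=> *; rewrite lieZr; exact: subspaceZ.
- move=> f v ff Lv [t [w [ht Lw IH]]]; rewrite lie_leibniz IH.
  exists 0, (lie (lie e f) v + lie f (t + w)); split; rewrite ?add0r //.
    exact: subspace0.
  apply: adc_add; first by apply: lie_hm => //; exact: lie_ef.
  rewrite lieDr; apply: adc_add; last exact: adc_ad.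
  have [c fc] := lie_hf ht ff.
  by rewrite lieC fc -scaleNr; apply/adc_scale/adc_gen.
Qed.

(** [ad e] preserves n^+, sends the Cartan part into n^+ and n^- into the sum of the Cartan part and
    n^-. *)
Lemma triangular_e e x : ise e -> triangular x -> triangular (lie e x).
Proof.
move=> ee [u [t [v [Lu ht Lv ->]]]].
rewrite !lieDr; apply: subspaceD (triangular_subspace) _ _.
  apply: subspaceD (triangular_subspace) _ _; first by apply/tri_p/adc_ad.
  have [c et] := lie_he ht ee.
  by rewrite lieC et -scaleNr; apply/tri_p/adc_scale/adc_gen.
have [t' [w [ht' Lw ->]]] := lie_em ee Lv.
by apply: subspaceD (triangular_subspace) _ _; [exact: tri_h|exact: tri_m].
Qed.

Lemma triangular_gens : [/\ triangular e0, triangular e1, triangular f0 & triangular f1].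
Proof.
by split; [apply: tri_p|apply: tri_p|apply: tri_m|apply: tri_m]; apply: adc_gen;
  [left|right|left|right].
Qed.

End Triangular.

Section RootSpaces.
Variables (K : numClosedFieldType) (L : lieAlgType K) (a : int).
Variables (e0 e1 f0 f1 h0 h1 : L).
Hypothesis se : serre2 a e0 e1 f0 f1 h0 h1.
Let cv := se_cv se.
Let ge3 : 3 <= a := cv_ge3 cv.

Lemma triangular_flip x : triangular e0 e1 f0 f1 h0 h1 x ->
  triangular f0 f1 e0 e1 (- h0) (- h1) x.
Proof.
move=> [u [t [v [Lu [c [d ->]] Lv ->]]]]; exists v, (c *: h0 + d *: h1), u; split=> //.
  by exists (- c), (- d); rewrite !scaleNr !scalerN !opprK.
by rewrite addrC addrA addrAC.
Qed.

(** The sum of the three parts is stable under the generators, by [triangular_e] and its flip, so it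
    is an ideal containing them. *)
Lemma triangular_full x : triangular e0 e1 f0 f1 h0 h1 x.
Proof.
have flipK y : triangular f0 f1 e0 e1 (- h0) (- h1) y -> triangular e0 e1 f0 f1 h0 h1 y.
  move=> [u [t [v [Lu [c [d ->]] Lv ->]]]]; exists v, (c *: - h0 + d *: - h1), u.
  split=> //; last by rewrite addrC addrA addrAC.
  by exists (- c), (- d); rewrite !scaleNr !scalerN.
have [? ? ? ?] := triangular_gens e0 e1 f0 f1 h0 h1.
apply: (se_full se) => //; split; first exact: triangular_subspace.
apply: (cv_gen cv); first exact: triangular_subspace.
move=> y Ty; have Ty' := triangular_flip Ty; split.
- by apply: (triangular_e se) => //; left.
- by apply: (triangular_e se) => //; right.
- by apply/flipK/(triangular_e (serre2_flip se)) => //; left.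
- by apply/flipK/(triangular_e (serre2_flip se)) => //; right.
Qed.

(** [e0] is kept apart from the listed weights so that [wt_simple] can read off that the root space
    of alpha_0 is a line. Crude bounds suffice on the negative part, since only weights with
    [q >= 1], or with [q = 0 <= p], are examined later. *)
Lemma root_decomp x : exists c z, x = c *: e0 + z /\ wt_span a h0 h1 (fun p q =>
  [\/ p = 0 /\ q = 0, [/\ 1 <= q, 0 <= p & p <= a * q],
      q <= -1 | p = -1 /\ q = 0]) z.
Proof.
have [u [t [v [Lu [c [d ->]] Lv ->]]]] := triangular_full x.
have [c0 [z [-> zw]]] := pos_part_decomp se Lu.
have [c1 [y [-> yw]]] := pos_part_decomp (serre2_flip se) Lv.
exists c0, (z + (c *: h0 + d *: h1) + (c1 *: f0 + y)); split; first by rewrite !addrA.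
have sub := wt_span_subspace a h0 h1; have gen := @wt_span_gen K L a h0 h1.
do ![apply: subspaceD (sub _) _ _|apply: subspaceZ (sub _) _].
- by apply: wt_spanS zw => p q ?; apply: Or42.
- by apply: gen (wt_h0 cv); apply: Or41.
- by apply: gen (wt_h1 cv); apply: Or41.
- apply: (gen _ (-1) 0); first exact: Or44.
  by have /wt_flip := wt_e0 (se_cv (serre2_flip se)); rewrite oppr0.
- move: yw; apply: lin_spanS => w [p [q [[q1 _ _] /wt_flip ww]]].
  by exists (- p), (- q); split=> //; apply: Or43; lia.
Qed.

Lemma wt_cases p q x : wt a h0 h1 p q x -> x != 0 ->
  (p = 1 /\ q = 0) \/ [\/ p = 0 /\ q = 0, [/\ 1 <= q, 0 <= p & p <= a * q],
                          q <= -1 | p = -1 /\ q = 0].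
Proof.
move=> wx /eqP xN0; apply: contrapT => npq; apply: xN0.
have [c [z [xE zw]]] := root_decomp x.
apply: (wt_span_notin ge3 _ wx npq (W := fun p q => (p = 1 /\ q = 0) \/
  [\/ p = 0 /\ q = 0, [/\ 1 <= q, 0 <= p & p <= a * q], q <= -1 | p = -1 /\ q = 0])).
rewrite xE; apply: subspaceD (wt_span_subspace _ _ _ _) _ _.
  apply: subspaceZ (wt_span_subspace _ _ _ _) _.
  by apply: wt_span_gen (wt_e0 cv); left.
by apply: wt_spanS zw; right.
Qed.

Lemma wt_bound p q x : wt a h0 h1 p q x -> x != 0 -> 1 <= q -> 0 <= p <= a * q.
Proof. by move=> wx xN0 q1; case: (wt_cases wx xN0) => [|[|[]||]]; lia. Qed.

Lemma wt_multiple p x : wt a h0 h1 p 0 x -> x != 0 -> 0 <= p -> p <= 1.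
Proof. by move=> wx xN0 p0; case: (wt_cases wx xN0) => [|[|[]||]]; lia. Qed.

Lemma wt_simple x : wt a h0 h1 1 0 x -> exists c, x = c *: e0.
Proof.
move=> wx; have [c [z [xE zw]]] := root_decomp x; exists c.
suff : x - c *: e0 = 0 by move/eqP; rewrite subr_eq0 => /eqP.
apply: (wt_span_notin ge3 (p := 1) (q := 0)).
- by rewrite xE addrAC subrr add0r; exact: zw.
- rewrite -scaleNr; apply: subspaceD (wt_subspace a h0 h1 1 0) wx _.
  exact: subspaceZ (wt_subspace a h0 h1 1 0) (wt_e0 cv).
- by case=> [|[]||]; lia.
Qed.

Let wt_f0 : wt a h0 h1 (-1) 0 f0.
Proof. by have /wt_flip := wt_e0 (se_cv (serre2_flip se)); rewrite oppr0. Qed.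

Lemma wt_lower p q x (m : nat) : wt a h0 h1 p q x ->
  wt a h0 h1 (p - m%:Z) q (iter m (lie f0) x).
Proof.
move=> wx; have := wt_iter m wt_f0 wx.
by rewrite mul0rn add0r addrC mulNrn natz.
Qed.

Lemma wt_reflect p q x : wt a h0 h1 p q x -> x != 0 -> 1 <= q -> 0 <= 2 * p - a * q ->
  exists2 y, wt a h0 h1 (a * q - p) q y & y != 0.
Proof.
move=> wx xN0 q1 m0; pose m := absz (2 * p - a * q)%R.
exists (iter m (lie f0) x).
  by have := wt_lower m wx; congr wt; rewrite /m; lia.
apply/eqP => fx; move/eqP: (xN0); apply.
have [hx _] := wx.
(* [e0] is nilpotent on [x]: after [a q + 1] steps the first coordinate exceeds the bound [a q] of
   [wt_bound]. *)
apply: (sl2_iter_inj (cv_e0f0 cv) (cv_h0e0 cv) (cv_h0f0 cv) (m := m)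
   (N := (absz (a * q)%R).+1) _ _ fx).
  by rewrite hx -[2 * p - a * q]gez0_abs.
apply/eqP/negP => /negP /(wt_bound _) bd.
have := bd _ _ (wt_iter _ (wt_e0 cv) wx); rewrite mul0rn add0r natz => /(_ q1).
have := wt_bound wx xN0 q1.
lia.
Qed.

End RootSpaces.

(** * Real roots and the sign of [x, omega x] *)

Section RealRoots.
Variables (K : numClosedFieldType) (L : lieAlgType K) (a : int).

(* Descent: reflecting in a simple root on which the weight is positive keeps
   the form [p^2 + q^2 - a p q] and decreases the height. *)
Lemma wt_norm_le1 (e0 e1 f0 f1 h0 h1 : L) (p q : int) x : serre2 a e0 e1 f0 f1 h0 h1 ->
  wt a h0 h1 p q x -> x != 0 -> 0 <= p -> 0 <= q -> 0 < p + q ->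
  p ^+ 2 + q ^+ 2 - a * p * q <= 1.
Proof.
move=> se; have ge3 := cv_ge3 (se_cv se).
have [N] := ubnP (absz (p + q)%R).
elim: N => // N IH in e0 e1 f0 f1 h0 h1 se p q x *.
wlog qp : e0 e1 f0 f1 h0 h1 se p q / q <= p.
  move=> wl lN wx xN0 p0 q0 pq; have [qp|/ltW pq'] := leP q p.
    exact: (wl _ _ _ _ _ _ se p q qp).
  have := wl _ _ _ _ _ _ (serre2_swap se) q p pq'.
  rewrite (addrC q p) => /(_ lN _ xN0 q0 p0 pq).
  have -> : p ^+ 2 + q ^+ 2 - a * p * q = q ^+ 2 + p ^+ 2 - a * q * p by ring.
  by apply; apply/wt_swap.
move=> lN wx xN0 p0 q0 pq.
have [q1|q1] := leP 1 q; last first.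
  have qE : q = 0 by lia.
  by have := wt_multiple se _ xN0 p0; rewrite qE in wx * => /(_ wx); nia.
(* For [q <= p <= a q / 2] one has [p (a q - p) >= (a - 1) q^2], so the form is at most
   [(2 - a) q^2 < 0]. *)
have [m0|m0] := leP (2 * p) (a * q); first by nia.
have [y wy yN0] : exists2 y, wt a h0 h1 (a * q - p) q y & y != 0.
  by apply: (wt_reflect se wx xN0); lia.
have bd := wt_bound se wx xN0 q1.
have := IH _ _ _ _ _ _ se _ _ _ _ wy yN0.
have -> : (a * q - p) ^+ 2 + q ^+ 2 - a * (a * q - p) * q =
  p ^+ 2 + q ^+ 2 - a * p * q by ring.
by apply; lia.
Qed.

(** Adding alpha_0 raises the form by [2 p - a q + 1 > 0], beyond the bound of [wt_norm_le1]. *)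
Lemma lie_e0_highest (e0 e1 f0 f1 h0 h1 : L) (p q : int) x :
  serre2 a e0 e1 f0 f1 h0 h1 -> wt a h0 h1 p q x -> 0 <= p -> 0 <= q ->
  0 < 2 * p - a * q -> p ^+ 2 + q ^+ 2 - a * p * q = 1 -> lie e0 x = 0.
Proof.
move=> se wx p0 q0 m0 n1; apply: contrapT => /eqP ex.
have := wt_norm_le1 se (wt_lie (wt_e0 (se_cv se)) wx) ex.
by nia.
Qed.

Definition antilinear_lie_morphism (om : L -> L) : Prop :=
  [/\ forall x y, om (x + y) = om x + om y,
      forall c x, om (c *: x) = c^* *: om x &
      forall x y, om (lie x y) = lie (om x) (om y)].

Variable om : L -> L.
Hypothesis omP : antilinear_lie_morphism om.

(* The left-hand side is [beta([x, om x])] for the weight [beta = (p, q)]. *)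
Definition neg_contravariant (h0 h1 : L) (p q : int) := forall x c d,
  wt a h0 h1 p q x -> x != 0 -> lie x (om x) = c *: h0 + d *: h1 ->
  c * (2 * p - a * q)%:~R + d * (2 * q - a * p)%:~R <= 0.

Lemma neg_contravariant_swap (h0 h1 : L) (p q : int) :
  neg_contravariant h1 h0 q p -> neg_contravariant h0 h1 p q.
Proof.
by move=> nc x c d /wt_swap wx xN0 xE; rewrite addrC; apply: nc wx xN0 _; rewrite addrC.
Qed.

(** Here [x = b e0] and [[x, om x] = - |b|^2 h0], on which alpha_0 takes the value [-2 |b|^2]. *)
Lemma neg_contravariant_simple (e0 e1 f0 f1 h0 h1 : L) :
  serre2 a e0 e1 f0 f1 h0 h1 -> om e0 = - f0 -> neg_contravariant h0 h1 1 0.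
Proof.
case: omP => _ omZ _; move=> se ome x c d wx xN0 xE; have cv := se_cv se.
have [b bE] := wt_simple se wx.
have e0N0 : e0 != 0 by apply: contraNneq xN0; rewrite bE => ->; rewrite scaler0.
(* Bracketing with [e0] reads off the value of alpha_0 directly, whichever [c] and [d] represent the
   bracket. *)
have := congr1 (fun t => lie t e0) xE.
rewrite bE omZ ome !lieZl lieZr lieNr (cv_e0f0 cv) lieDl !lieZl.
have [-> ->] := wt_e0 cv.
rewrite lieNl (cv_h0e0 cv) !scalerN !scalerA -scalerDl -scaleNr.
move=> /eqP; rewrite -subr_eq0 -scalerBl scaler_eq0 (negbTE e0N0) orbF subr_eq0 => /eqP.
by move=> <-; rewrite oppr_le0 pmulr_lge0 ?mul_conjC_ge0 ?ltr0n.
Qed.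

Lemma neg_contravariant_reflect (e0 e1 f0 f1 h0 h1 : L) (p q : int) :
  serre2 a e0 e1 f0 f1 h0 h1 -> om e0 = - f0 -> om f0 = - e0 ->
  0 <= p -> 0 <= q -> 0 < 2 * p - a * q -> p ^+ 2 + q ^+ 2 - a * p * q = 1 ->
  neg_contravariant h0 h1 (a * q - p) q -> neg_contravariant h0 h1 p q.
Proof.
case: omP => _ omZ om_lie se ome omf p0 q0 m0 n1 nc x c d wx xN0 xE.
have cv := se_cv se; pose m := absz (2 * p - a * q)%R.
have mE : 2 * p - a * q = m%:Z by rewrite /m; lia.
have mpos : (0 < m)%N by rewrite /m; lia.
have ex := lie_e0_highest se wx p0 q0 m0 n1.
have hx : lie h0 x = m%:R *: x by case: wx => -> _; rewrite mE.
have om0 : om 0 = 0 by have := omZ 0 0; rewrite conjC0 !scale0r.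
have fy : lie f0 (om x) = 0 by rewrite -[f0]opprK -ome lieNl -om_lie ex om0 oppr0.
have ft : lie f0 (lie x (om x)) = (2 * c - a%:~R * d) *: f0.
  rewrite xE lieDr !lieZr (lieC f0) (cv_h0f0 cv) (lieC f0) (cv_h1f0 cv).
  by rewrite -!scaleNr !scalerA -scalerDl; congr (_ *: _); ring.
(* The sign [(-1)^m] comes from [om f0 = - e0] and cancels the one in [sl2_pairing]. *)
have om_iter : om (iter m (lie f0) x) = (-1) ^+ m *: iter m (lie e0) (om x).
  elim: m {mE mpos hx} => [|k IH]; first by rewrite expr0 scale1r.
  by rewrite !iterS om_lie IH omf lieNl lieZr exprS mulN1r scaleNr.
have := sl2_pairing (cv_e0f0 cv) (cv_h0f0 cv) mpos ex hx fy erefl ft.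
set B := (\prod_(l < m) _)%N => pairing.
have B0 : 0 < (B%:R : K).
  by rewrite ltr0n prodn_gt0 // => l; rewrite muln_gt0 subn_gt0 ltn_ord.
(* The right-hand side is [B] times the reflection of [c h0 + d h1] in [h0]. Reflecting both the
   root and the Cartan element preserves the pairing, so the sign is unchanged. *)
have {}pairing : lie (iter m (lie f0) x) (om (iter m (lie f0) x)) =
    (B%:R * (a%:~R * d - c)) *: h0 + (B%:R * d) *: h1.
  rewrite om_iter lieZr pairing scalerA mulrA -expr2 sqrr_sign mul1r xE.
  rewrite -(scalerA B%:R) -(scalerA B%:R) -scalerDr; congr (_ *: _).
  by rewrite addrAC -scalerBl; congr (_ *: _ + _); ring.
have wx' : wt a h0 h1 (a * q - p) q (iter m (lie f0) x).
  by have := wt_lower se m wx; congr wt; lia.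
have x'N0 : iter m (lie f0) x != 0.
  apply: contraNneq xN0 => fx; apply/eqP.
  exact: (sl2_highest_inj (cv_e0f0 cv) (cv_h0f0 cv) hx).
have := nc _ _ _ wx' x'N0 pairing.
rewrite -!(mulrA B%:R) -mulrDr pmulr_rle0 //; congr (_ <= _).
by rewrite !(rmorphB, rmorphM) /=; ring.
Qed.

End RealRoots.

(** * The Kac-Moody algebra of rank 2 *)

Lemma ord2P (i : 'I_2) : i = 0 \/ i = 1.
Proof. by case: i => [[|[|m]] lm] //; [left|right]; apply: val_inj. Qed.

Lemma sum_ord2 (V : nmodType) (F : 'I_2 -> V) : \sum_i F i = F 0 + F 1.
Proof.
by rewrite big_ord_recl big_ord1; congr (_ + F _); apply: val_inj.
Qed.

Section Morphism.
Variables (K : numClosedFieldType) (L L' : lieAlgType K) (phi : L -> L').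
Hypotheses (phiD : forall x y, phi (x + y) = phi x + phi y)
  (phiZ : forall c x, phi (c *: x) = c *: phi x)
  (phi_lie : forall x y, phi (lie x y) = lie (phi x) (phi y))
  (phi_surj : forall y, exists x, y = phi x).
Variables (a : int) (e0 e1 f0 f1 h0 h1 : L).

Let phi0 : phi 0 = 0.
Proof. by have := phiZ 0 0; rewrite !scale0r. Qed.

Lemma chevalley2_image : chevalley2 a e0 e1 f0 f1 h0 h1 ->
  chevalley2 a (phi e0) (phi e1) (phi f0) (phi f1) (phi h0) (phi h1).
Proof.
case=> ge3 r1 r2 r3 r4 r5 r6 r7 r8 r9 r10 r11 r12 r13 gen.
split=> //; rewrite -?phi_lie ?(r1, r2, r3, r4, r5) //.
- by rewrite r6.
- by rewrite r7.
- by rewrite r8.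
- by rewrite r9.
- by rewrite r10.
- by rewrite r11.
- by rewrite r12.
- by rewrite r13.
move=> U [U0 UD UZ] stab x y Uy.
have [x' ->] := phi_surj x; have [y' yE] := phi_surj y.
rewrite yE -phi_lie; apply: (gen (fun z => U (phi z))); last by rewrite -yE.
- split; first by rewrite phi0.
  + by move=> z t Uz Ut; rewrite phiD; exact: UD.
  + by move=> c z Uz; rewrite phiZ; exact: UZ.
- by move=> z /stab[]; rewrite !phi_lie.
Qed.

Lemma serre_elt_image : phi (serre_elt a e0 e1) = serre_elt a (phi e0) (phi e1).
Proof.
by rewrite /serre_elt; elim: _.+1 => //= k <-.
Qed.

End Morphism.

Section Rank2.
Variables (K : numClosedFieldType) (a : int) (ha : 3 <= a).
Local Notation A := (rank2_cartan a).
Local Notation gt := (km_tilde K A).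
Local Notation g := (kac_moody K A).
Local Notation te i := (tproj A (WE K i)).
Local Notation tf i := (tproj A (WF K i)).
Local Notation th i := (tproj A (WH K i)).

Lemma tilde_chevalley2 : chevalley2 a (te 0) (te 1) (tf 0) (tf 1) (th 0) (th 1).
Proof.
have HE i j : lie (th i) (te j) = (A i j)%:~R *: te j.
  by rewrite -tproj_lie -tprojZ; apply/tprojP/ceq_HE.
have HF i j : lie (th i) (tf j) = - (A i j)%:~R *: tf j.
  by rewrite -tproj_lie -tprojZ; apply/tprojP/ceq_HF.
have EF i : lie (te i) (tf i) = th i.
  by rewrite -tproj_lie; apply/tprojP/ceq_EF.
have EF0 i j : i != j -> lie (te i) (tf j) = 0.
  by move=> ij; rewrite -tproj_lie; apply/tprojP/ceq_EF0.
have HH i j : lie (th i) (th j) = 0.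
  by rewrite -tproj_lie; apply/tprojP/ceq_HH.
split; rewrite ?HE ?HF ?EF ?EF0 ?HH // ?mxE //= ?rmorphN ?opprK //.
move=> U sU stab.
(* Induction on the word representing the left factor: [ad [w, w']] is the commutator of [ad w] and
   [ad w'], and [h_i] is [[e_i, f_i]]. *)
suff main w y : U y -> U (lie (tproj A w) y).
  by move=> x y; rewrite -[x]treprK; exact: main.
elim: w y => [|w IHw w' IHw'|c w IHw|w IHw w' IHw'|i|i|i] y Uy.
- by rewrite (_ : tproj A _ = 0) // lie0l; exact: subspace0.
- by rewrite tprojD lieDl; apply: subspaceD; [|exact: IHw|exact: IHw'].
- by rewrite tprojZ lieZl; apply: subspaceZ; [|exact: IHw].
- have -> : lie (tproj A (WLie w w')) y =
      lie (tproj A w) (lie (tproj A w') y) - lie (tproj A w') (lie (tproj A w) y).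
    by rewrite lie_leibniz addrK -tproj_lie.
  apply: (subspaceD sU); first exact: IHw (IHw' _ Uy).
  by apply: (subspaceN sU); exact: IHw' (IHw _ Uy).
- by case: (ord2P i) => ->; case: (stab y Uy).
- by case: (ord2P i) => ->; case: (stab y Uy).
- rewrite -EF.
  have -> : lie (lie (te i) (tf i)) y = lie (te i) (lie (tf i) y) - lie (tf i) (lie (te i) y).
    by rewrite lie_leibniz addrK.
  have st z : U z -> U (lie (te i) z) /\ U (lie (tf i) z).
    by move=> /stab[? ? ? ?]; case: (ord2P i) => ->.
  have [/st[_ ?] /st[? _]] := st _ Uy.
  by apply: (subspaceD sU) => //; exact: subspaceN.
Qed.

Local Notation pr := (lie_proj (@km_radical_ideal K 2 A)).
Local Notation ce := (@chev_e K 2 A).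
Local Notation cf := (@chev_f K 2 A).
Local Notation ch := (@chev_h K 2 A).

Let cv := tilde_chevalley2.

(** Cartan elements have weight zero, so [J] meets the Cartan subalgebra trivially and lies in the
    radical. Leaving [x] and [y] free covers all four Serre relations, which use the [h_i] up to
    order and sign. *)
Lemma proj_ideal_eq0 (x y u : gt) :
  (forall i, lie x (th i) = 0 /\ lie y (th i) = 0) ->
  (exists J : set gt, [/\ is_ideal J, J u &
     forall z, J z -> wt_span a x y (fun p q => 1 <= q) z]) -> pr u = 0.
Proof.
move=> xyh [J [idJ Ju Jw]].
apply/(lie_projP (@km_radical_ideal K 2 A)); rewrite subr0.
apply: sub_gen_smallest; exists J => //; split=> // t [Jt [c tE]].
apply: (wt_span_notin ha (Jw _ Jt) (p := 0) (q := 0)); last by [].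
rewrite /wt !mulr0 subr0 !scale0r tE sum_ord2 !lieDr !lieZr.
have [-> ->] := xyh 0; have [-> ->] := xyh 1.
by rewrite !scaler0 addr0.
Qed.

Lemma kac_moody_serre2 : serre2 a (ce 0) (ce 1) (cf 0) (cf 1) (ch 0) (ch 1).
Proof.
have prD (x y : gt) : pr (x + y) = pr x + pr y :> g by exact: lie_projD.
have prZ c (x : gt) : pr (c *: x) = c *: pr x :> g by exact: lie_projZ.
have prL (x y : gt) : pr (lie x y) = lie (pr x) (pr y) :> g by exact: lie_proj_lie.
have prS (y : g) : exists x, y = pr x by exists (lie_repr y); rewrite lie_reprK.
have hh i j : lie (th i) (th j) = 0 by rewrite -tproj_lie; apply/tprojP/ceq_HH.
have cv' := chevalley2_swap cv.
split.
- exact: chevalley2_image prD prZ prL prS _ _ _ _ _ _ _ cv.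
- rewrite -(serre_elt_image prL); apply: proj_ideal_eq0 (serre_ideal cv).
  by move=> i; rewrite !hh.
- rewrite -(serre_elt_image prL); apply: proj_ideal_eq0 (serre_ideal cv').
  by move=> i; rewrite !hh.
- rewrite -(serre_elt_image prL).
  apply: proj_ideal_eq0 (serre_ideal (chevalley2_flip cv)).
  by move=> i; rewrite !lieNl !hh oppr0.
- rewrite -(serre_elt_image prL).
  apply: proj_ideal_eq0 (serre_ideal (chevalley2_flip cv')).
  by move=> i; rewrite !lieNl !hh oppr0.
- move=> U [[U0 UD UZ] Ul] Ue0 Ue1 Uf0 Uf1 x.
  have [x' ->] := prS x; rewrite -[x']treprK.
  elim: (trepr x') => [|w IHw w' IHw'|c w IHw|w IHw w' IHw'|i|i|i].
  + by have := prZ 0 (tproj A (WZero K 2)); rewrite !scale0r => ->.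
  + by rewrite tprojD prD; exact: UD.
  + by rewrite tprojZ prZ; exact: UZ.
  + by rewrite tproj_lie prL; exact: Ul.
  + by case: (ord2P i) => ->.
  + by case: (ord2P i) => ->.
  + have -> : th i = lie (te i) (tf i) by rewrite -tproj_lie; apply/tprojP/ceq_sym/ceq_EF.
    by rewrite prL; apply: Ul; case: (ord2P i) => ->.
Qed.

Local Notation h0 := (ch 0).
Local Notation h1 := (ch 1).

Lemma cartan_elt2 (c : 'rV[K]_2) : cartan_elt A c = c 0 0 *: h0 + c 0 1 *: h1.
Proof. exact: sum_ord2. Qed.

Lemma weight_eval2 p q (c : 'rV[K]_2) : weight_eval A (root2 p q) c =
  c 0 0 * (2 * p - a * q)%:~R + c 0 1 * (2 * q - a * p)%:~R.
Proof.
rewrite /weight_eval sum_ord2 /pair_coroot !sum_ord2 !mxE /=.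
by congr (_ * _%:~R + _ * _%:~R); ring.
Qed.

Lemma root_space2 p q (x : g) : root_space (root2 p q) x <-> wt a h0 h1 p q x.
Proof.
split=> [rx|[x0 x1] c]; last first.
  by rewrite cartan_elt2 weight_eval2 lieDl !lieZl x0 x1 !scalerA -scalerDl.
have := rx (delta_mx 0 0); have := rx (delta_mx 0 1).
rewrite !cartan_elt2 !weight_eval2 !mxE /= !scale1r !scale0r !mul1r !mul0r.
by rewrite !addr0 !add0r.
Qed.

End Rank2.

(** * Real roots and the sequence F *)

Section Fsequence.
Variables (a : int) (ha : 3 <= a).
Local Notation F := (Fseq a).

Lemma FseqSS k : F k.+2 = a * F k.+1 - F k. Proof. by []. Qed.

Lemma Fseq_ge0_lt k : 0 <= F k < F k.+1.
Proof.
elim: k => [//|k /andP[F0 Fk]]; rewrite FseqSS; nia.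
Qed.

Lemma Fseq_homo i j : (i < j)%N -> F i < F j.
Proof.
move: i j; apply: (homo_ltn (r := fun x y : int => x < y)) => [x y z|k].
  exact: lt_trans.
by case/andP: (Fseq_ge0_lt k).
Qed.

Lemma Fseq_norm k : F k.+1 ^+ 2 + F k ^+ 2 - a * F k.+1 * F k = 1.
Proof.
elim: k => [|k IH]; first by rewrite /=; ring.
by rewrite FseqSS -[RHS]IH; ring.
Qed.

End Fsequence.

Section RealRoots2.
Variables (K : numClosedFieldType) (a : int) (ha : 3 <= a).
Local Notation F := (Fseq a).
Local Notation A := (rank2_cartan a).
Local Notation g := (kac_moody K A).

Definition real_pos (p q : int) :=
  exists k, (p = F k.+1 /\ q = F k) \/ (p = F k /\ q = F k.+1).

Lemma simple_reflection2 p q :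
  simple_reflection A 0 (root2 p q) = root2 (a * q - p) q /\
  simple_reflection A 1 (root2 p q) = root2 p (a * p - q).
Proof.
rewrite /simple_reflection /pair_coroot; split; apply/rowP => i;
  by case: (ord2P i) => ->; rewrite sum_ord2 !mxE /=; ring.
Qed.

(** A simple reflection carries one family to the other with the index shifted by one, except that
    it changes the sign of its own simple root. *)
Lemma weyl_orbit_cases i r : weyl_orbit A (simple_root i) r ->
  exists p q, r = root2 p q /\ (real_pos p q \/ real_pos (- p) (- q)).
Proof.
move=> [s ->] {r}; elim: s => [|j s [p [q [sE pq]]]] /=; last rewrite sE {sE}.
  case: (ord2P i) => ->.
    exists 1, 0; split; last by left; exists 0%N; left.
    by rewrite /root2 scale1r scale0r addr0.
  exists 0, 1; split; last by left; exists 0%N; right.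
  by rewrite /root2 scale1r scale0r add0r.
have refl0 p' q' : real_pos p' q' ->
    real_pos (a * q' - p') q' \/ real_pos (- (a * q' - p')) (- q').
  move=> [k [|] [-> ->]]; last by left; exists k.+1; left.
  case: k => [|k]; last by left; exists k; right; split=> //; rewrite FseqSS; ring.
  by right; exists 0%N; left; split=> /=; ring.
have swap p' q' : real_pos p' q' -> real_pos q' p'.
  by move=> [k [|] [? ?]]; exists k; [right|left].
have [r0 r1] := simple_reflection2 p q.
case: (ord2P j) => ->; rewrite ?r0 ?r1.
  exists (a * q - p), q; split=> //; case: pq => [/refl0 //|/refl0].
  have -> : a * - q - - p = - (a * q - p) by ring.
  by rewrite !opprK => -[]; [right|left].
exists p, (a * p - q); split=> //; case: pq => /swap/refl0.
  by case=> /swap; [left|right].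
have -> : a * - p - - q = - (a * p - q) by ring.
by rewrite !opprK => -[] /swap; [right|left].
Qed.

Lemma weyl_orbit_real_pos p q : real_pos p q ->
  exists i, weyl_orbit A (simple_root i) (root2 p q).
Proof.
have refl j i r : weyl_orbit A (simple_root i) r ->
    exists i, weyl_orbit A (simple_root i) (simple_reflection A j r).
  by move=> [s ->]; exists i, (j :: s).
suff main k : (exists i, weyl_orbit A (simple_root i) (root2 (F k.+1) (F k))) /\
    (exists i, weyl_orbit A (simple_root i) (root2 (F k) (F k.+1))).
  by move=> [k [|] [-> ->]]; case: (main k).
elim: k => [|k [[i r] [j s]]].
  split; [exists 0|exists 1]; exists [::];
    by rewrite /root2 /= scale1r scale0r ?addr0 ?add0r.
have [r0 r1] := simple_reflection2 (F k) (F k.+1).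
have [r2 r3] := simple_reflection2 (F k.+1) (F k).
by split; [rewrite FseqSS -r0|rewrite FseqSS -r3]; apply: refl; eassumption.
Qed.

Lemma real_root_vector_wt (x : g) : is_real_root_vector x ->
  exists p q, wt a (chev_h K A 0) (chev_h K A 1) p q x /\
    (real_pos p q \/ real_pos (- p) (- q)).
Proof.
move=> [_ [r [_ [i /weyl_orbit_cases[p [q [-> pq]]]]] rx]].
by exists p, q; split=> //; apply/root_space2.
Qed.

Lemma real_pos_root_vector p q (x : g) : real_pos p q -> x != 0 ->
  root_space (root2 p q) x -> is_real_root_vector x.
Proof.
move=> pq xN0 rx; split=> //; exists (root2 p q) => //; split.
  split; last by exists x.
  apply/eqP => /rowP r0; have := r0 0; have := r0 1; rewrite !mxE /= !mulr1 !mulr0.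
  case: pq => k [|] [-> ->]; have := Fseq_ge0_lt ha k; lia.
exact: weyl_orbit_real_pos.
Qed.

Lemma npos_wt_span (x : g) : npos x ->
  wt_span a (chev_h K A 0) (chev_h K A 1) (fun p q => [/\ 0 <= p, 0 <= q & 0 < p + q]) x.
Proof.
have cv := se_cv (kac_moody_serre2 K ha).
apply; split; first split.
- exact: wt_span_subspace.
- move=> y z; move: y; apply: lin_span_ind.
    have sW := wt_span_subspace a (chev_h K A 0) (chev_h K A 1)
      (fun p q => [/\ 0 <= p, 0 <= q & 0 < p + q]).
    split.
    + by move=> _; rewrite lie0l; exact: subspace0.
    + by move=> u v IHu IHv zw; rewrite lieDl; apply: (subspaceD sW); auto.
    + by move=> c u IHu zw; rewrite lieZl; apply: (subspaceZ _ sW); auto.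
  move=> y [p [q [[p0 q0 pq] wy]]]; apply: wt_span_lie wy _ => r s [? ? ?]; split; lia.
- move=> _ [i _ <-]; case: (ord2P i) => ->.
    by apply: wt_span_gen (wt_e0 cv).
  by apply: wt_span_gen (wt_e1 cv).
Qed.

End RealRoots2.

(** * Supports of nilpotent elements *)

Section WeightSpan.
Variables (K : numClosedFieldType) (L : lieAlgType K) (a : int) (h0 h1 : L).
Implicit Types (W : int -> int -> Prop) (x : L).

Lemma wt_span_split W1 W2 x :
  wt_span a h0 h1 (fun p q => W1 p q \/ W2 p q) x ->
  exists y z, [/\ wt_span a h0 h1 W1 y, wt_span a h0 h1 W2 z & x = y + z].
Proof.
have s1 := wt_span_subspace a h0 h1 W1; have s2 := wt_span_subspace a h0 h1 W2.
move: x; apply: lin_span_ind; first split.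
- by exists 0, 0; split; rewrite ?addr0 //; [exact: subspace0 s1|exact: subspace0 s2].
- move=> _ _ [y [z [Wy Wz ->]]] [y' [z' [Wy' Wz' ->]]]; exists (y + y'), (z + z').
  by split; [exact: (subspaceD s1)|exact: (subspaceD s2)|rewrite addrACA].
- move=> c _ [y [z [Wy Wz ->]]]; exists (c *: y), (c *: z).
  by split; [exact: (subspaceZ _ s1)|exact: (subspaceZ _ s2)|rewrite scalerDr].
- move=> x [p [q [[W1pq|W2pq] wx]]].
    exists x, 0; split; rewrite ?addr0 //; [exact: wt_span_gen wx|exact: subspace0 s2].
  exists 0, x; split; rewrite ?add0r //; [exact: subspace0 s1|exact: wt_span_gen wx].
Qed.

Lemma wt_span_unique W x :
  (forall p q r s, W p q -> W r s -> p = r /\ q = s) -> wt_span a h0 h1 W x ->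
  x = 0 \/ exists p q, W p q /\ wt a h0 h1 p q x.
Proof.
move=> uniq; move: x; apply: lin_span_ind; last by right.
split; first by left.
- move=> x y [->|[p [q [Wpq wx]]]]; first by rewrite add0r.
  case=> [->|[r [s [Wrs wy]]]]; first by rewrite addr0; right; exists p, q.
  have [rp sq] := uniq _ _ _ _ Wrs Wpq; rewrite rp sq in wy.
  by right; exists p, q; split=> //; exact: subspaceD (wt_subspace _ _ _ _ _) _ _.
- move=> c x [->|[p [q [Wpq wx]]]]; first by left; rewrite scaler0.
  by right; exists p, q; split=> //; exact: subspaceZ (wt_subspace _ _ _ _ _) _.
Qed.

Lemma wt_lie_cartan (p q : int) (c d : K) x : wt a h0 h1 p q x ->
  lie (c *: h0 + d *: h1) x =
    (c * (2 * p - a * q)%:~R + d * (2 * q - a * p)%:~R) *: x.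
Proof. by move=> [x0 x1]; rewrite lieDl !lieZl x0 x1 !scalerA -scalerDl. Qed.

(** The part of [x] on weights with another eigenvalue is itself an [l]-eigenvector, hence zero. *)
Lemma wt_span_eigen W (c d l : K) x : wt_span a h0 h1 W x ->
  lie (c *: h0 + d *: h1) x = l *: x ->
  wt_span a h0 h1 (fun p q =>
    W p q /\ c * (2 * p - a * q)%:~R + d * (2 * q - a * p)%:~R = l) x.
Proof.
set h := _ + _; pose ev (p q : int) := c * (2 * p - a * q)%:~R + d * (2 * q - a * p)%:~R.
pose W1 p q := W p q /\ ev p q = l; pose W2 p q := W p q /\ ev p q <> l.
move=> Wx hx; have : wt_span a h0 h1 (fun p q => W1 p q \/ W2 p q) x.
  apply: wt_spanS Wx => p q Wpq.
  by case: (pselect (ev p q = l)) => ?; [left|right].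
move=> /wt_span_split[y [z [W1y W2z xE]]].
have hy : lie h y = l *: y.
  move: y W1y {xE}; apply: lin_span_ind.
    split; first by rewrite lie0r scaler0.
      by move=> u v hu hv; rewrite lieDr hu hv scalerDr.
    by move=> b u hu; rewrite lieZr hu !scalerA mulrC.
  by move=> y [p [q [[_ <-] wy]]]; exact: wt_lie_cartan.
have hz : lie h z = l *: z.
  by move: hx; rewrite xE lieDr scalerDr hy => /addrI.
suff z0 : z = 0 by rewrite xE z0 addr0.
apply: (eig_span_disjoint (h := h) (S1 := fun m => m <> l) (S2 := fun m => m = l)) => //.
  move: W2z; apply: lin_spanS => y' [p [q [[_ pq] wy]]].
  by exists (ev p q) => //; exact: wt_lie_cartan.
by apply: lin_span_gen; exists l.
Qed.

End WeightSpan.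

Lemma scaler_inj_val (K : fieldType) (V : lmodType K) (x : V) (b c : K) :
  x != 0 -> b *: x = c *: x -> b = c.
Proof.
move=> xN0 /eqP; rewrite -subr_eq0 -scalerBl scaler_eq0 (negbTE xN0) orbF subr_eq0.
by move/eqP.
Qed.

(** * Signs at real roots and the two implications *)

Section Main.
Variables (K : numClosedFieldType) (a : int) (ha : 3 <= a).
Local Notation F := (Fseq a).
Local Notation A := (rank2_cartan a).
Local Notation g := (kac_moody K A).
Local Notation h0 := (chev_h K A 0).
Local Notation h1 := (chev_h K A 1).
Variable om : g -> g.
Hypothesis omP : is_compact_involution om.

Let antilinear_om : antilinear_lie_morphism om.
Proof. by case: omP => -[_ ? ? ?] _ _ _; split. Qed.

(** Both families advance together: reflecting [(F_(k+2), F_(k+1))] in alpha_0 gives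
    [(F_k, F_(k+1))], a member of the other family. *)
Lemma neg_contravariant_real k :
  neg_contravariant a om h0 h1 (F k.+1) (F k) /\
  neg_contravariant a om h0 h1 (F k) (F k.+1).
Proof.
have se := kac_moody_serre2 K ha; have se' := serre2_swap se.
have [_ ome omf _] := omP.
elim: k => [|k [IH IH']].
  split.
    exact: (neg_contravariant_simple antilinear_om se (ome 0)
              : neg_contravariant a om h0 h1 1 0).
  apply: neg_contravariant_swap.
  exact: (neg_contravariant_simple antilinear_om se' (ome 1)
            : neg_contravariant a om h1 h0 1 0).
have Fk := Fseq_ge0_lt ha k; have Fk1 := Fseq_ge0_lt ha k.+1.
have Fn := Fseq_norm a k.+1.
have E : a * F k.+1 - F k.+2 = F k by rewrite FseqSS; ring.
split; last apply: neg_contravariant_swap.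
  apply: (neg_contravariant_reflect antilinear_om se (ome 0) (omf 0)); rewrite ?E //; lia.
apply: (neg_contravariant_reflect antilinear_om se' (ome 1) (omf 1)); rewrite ?E //; try lia.
exact: neg_contravariant_swap.
Qed.

Lemma not_single_real (p q : int) (c : 'rV[K]_2) (x : g) :
  real_pos a p q -> wt a h0 h1 p q x -> x != 0 ->
  lie x (om x) = cartan_elt A c -> lie (cartan_elt A c) x != 2 *: x.
Proof.
move=> pq wx xN0 xE; apply/eqP; rewrite cartan_elt2 (wt_lie_cartan _ _ wx).
rewrite cartan_elt2 in xE.
move=> /(scaler_inj_val xN0) v2.
suff : (2 : K) <= 0 by rewrite lern0.
rewrite -v2; case: pq => k [|] [pE qE]; have [nc nc'] := neg_contravariant_real k.
  by rewrite pE qE in wx *; exact: nc wx xN0 xE.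
by rewrite pE qE in wx *; exact: nc' wx xN0 xE.
Qed.

(** Subtracting the equations leaves a vanishing sum of nonnegative terms, which forces [u = v = 0]
    and contradicts the value 2. *)
Lemma height_eq2_strict (u v : K) (p q r s : int) : 0 <= u -> 0 <= v ->
  u * p%:~R + v * q%:~R = 2 -> u * r%:~R + v * s%:~R = 2 -> p < r -> q < s -> False.
Proof.
move=> u0 v0 e1 e2 pr qs.
have rp : 0 < (r - p)%:~R :> K by rewrite ltr0z subr_gt0.
have sq : 0 < (s - q)%:~R :> K by rewrite ltr0z subr_gt0.
have : u * (r - p)%:~R + v * (s - q)%:~R = 0.
  by rewrite !rmorphB /= !mulrBr addrACA -opprD e1 e2 subrr.
move=> /eqP; rewrite paddr_eq0 ?mulr_ge0 ?(ltW rp) ?(ltW sq) //.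
rewrite !mulf_eq0 (gt_eqF rp) (gt_eqF sq) !orbF => /andP[/eqP uE /eqP vE].
by move: e1; rewrite uE vE !mul0r addr0 => /esym/eqP; rewrite pnatr_eq0.
Qed.

Lemma weight_eval_simple (c : 'rV[K]_2) (p q : int) :
  weight_eval A (root2 p q) c =
  weight_eval A (simple_root 0) c * p%:~R + weight_eval A (simple_root 1) c * q%:~R.
Proof.
have s0 : simple_root 0 = root2 1 0 by rewrite /root2 scale1r scale0r addr0.
have s1 : simple_root 1 = root2 0 1 by rewrite /root2 scale1r scale0r add0r.
rewrite s0 s1 !weight_eval2 !rmorphB !rmorphM /=; ring.
Qed.

Lemma dominant_real_span (X Y H : g) : is_sl2_triple X Y H ->
  lin_span (@is_real_root_vector K 2 A) X -> Y = om X -> is_dominant H ->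
  exists (i j : nat) (c0 c1 : K) (E0 E1 : g),
     [/\ [\/ i.+1 = j, i = j | i = j.+1],
         E0 != 0 /\ root_space (root2 (F i.+1) (F i)) E0,
         E1 != 0 /\ root_space (root2 (F j) (F j.+1)) E1 &
         [/\ X = c0 *: E0 + c1 *: E1, Y = om X & H = lie X Y]].
Proof.
move=> [[XN0 _ _] [Xpos _ _] [HX _ XY]] Xreal YE [c HE dom].
set u := weight_eval A (simple_root 0) c; set v := weight_eval A (simple_root 1) c.
have u0 : 0 <= u := dom 0; have v0 : 0 <= v := dom 1.
have evE (p q : int) : c 0 0 * (2 * p - a * q)%:~R + c 0 1 * (2 * q - a * p)%:~R =
    u * p%:~R + v * q%:~R by rewrite -weight_eval2 weight_eval_simple.
have {Xreal} : wt_span a h0 h1 (fun p q => real_pos a p q \/ real_pos a (- p) (- q)) X.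
  apply: lin_spanS Xreal => x /real_root_vector_wt[p [q [wx pq]]].
  by exists p, q.
move=> /wt_span_split[X' [X'' [X'r X''r XE]]].
have pos_pq p q : real_pos a p q -> [/\ 0 <= p, 0 <= q & 0 < p + q].
  by case=> k [|] [-> ->]; have := Fseq_ge0_lt ha k; split; lia.
(* [X''] is supported on negative roots, yet it equals [X - X'] with both terms in the positive
   part. *)
have X''0 : X'' = 0.
  apply: (wt_span_disjoint ha (W1 := fun p q => [/\ 0 <= p, 0 <= q & 0 < p + q]) _ _ X''r).
    by move=> p q [p0 q0 pq] /pos_pq[]; lia.
  have -> : X'' = X - X' by rewrite XE addrAC subrr add0r.
  apply: subspaceD (wt_span_subspace _ _ _ _) _ _; first exact: npos_wt_span.
  apply: subspaceN (wt_span_subspace _ _ _ _) _.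
  by apply: wt_spanS X'r => p q /pos_pq.
have {X'' X''r X''0 XE X'r X'} Xr : wt_span a h0 h1 (real_pos a) X.
  by rewrite XE X''0 addr0.
rewrite HE cartan_elt2 in HX.
pose W0 p q := exists k, [/\ p = F k.+1, q = F k & u * p%:~R + v * q%:~R = 2].
pose W1 p q := exists k, [/\ p = F k, q = F k.+1 & u * p%:~R + v * q%:~R = 2].
have {}Xr : wt_span a h0 h1 (fun p q => W0 p q \/ W1 p q) X.
  apply: wt_spanS (wt_span_eigen Xr HX) => p q [[k [|] [pE qE]]]; rewrite evE => e2.
    by left; exists k.
  by right; exists k.
have [x0 [x1 [x0W x1W XE]]] := wt_span_split Xr.
have Fne k l : (k < l)%N -> u * (F k.+1)%:~R + v * (F k)%:~R = 2 ->
    u * (F l.+1)%:~R + v * (F l)%:~R = 2 -> False.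
  by move=> kl e1 e2; apply: (height_eq2_strict u0 v0 e1 e2); exact: Fseq_homo.
have Fne' k l : (k < l)%N -> u * (F k)%:~R + v * (F k.+1)%:~R = 2 ->
    u * (F l)%:~R + v * (F l.+1)%:~R = 2 -> False.
  by move=> kl e1 e2; apply: (height_eq2_strict u0 v0 e1 e2); exact: Fseq_homo.
have U0 p q r s : W0 p q -> W0 r s -> p = r /\ q = s.
  move=> [k [-> -> e1]] [l [-> -> e2]].
  by have [kl|kl|->] := ltngtP k l => //; [case: (Fne _ _ kl e1 e2)|case: (Fne _ _ kl e2 e1)].
have U1 p q r s : W1 p q -> W1 r s -> p = r /\ q = s.
  move=> [k [-> -> e1]] [l [-> -> e2]].
  by have [kl|kl|->] := ltngtP k l => //; [case: (Fne' _ _ kl e1 e2)|case: (Fne' _ _ kl e2 e1)].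
have single p q : real_pos a p q -> wt a h0 h1 p q X -> False.
  move=> pq wX; have xE : lie X (om X) = cartan_elt A c by rewrite -YE XY.
  by have /eqP := not_single_real pq wX XN0 xE; apply; rewrite cartan_elt2.
have x0N0 : x0 != 0.
  apply/eqP => x00; rewrite x00 add0r in XE; rewrite -XE in x1W.
  case: (wt_span_unique U1 x1W) => [X0|[p [q [[k [pE qE _]] wX]]]].
    by rewrite X0 eqxx in XN0.
  by apply: single wX; exists k; right.
have x1N0 : x1 != 0.
  apply/eqP => x10; rewrite x10 addr0 in XE; rewrite -XE in x0W.
  case: (wt_span_unique U0 x0W) => [X0|[p [q [[k [pE qE _]] wX]]]].
    by rewrite X0 eqxx in XN0.
  by apply: single wX; exists k; left.
case: (wt_span_unique U0 x0W) => [x00|[_ [_ [[i [-> -> ei]] w0]]]].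
  by rewrite x00 eqxx in x0N0.
case: (wt_span_unique U1 x1W) => [x10|[_ [_ [[j [-> -> ej]] w1]]]].
  by rewrite x10 eqxx in x1N0.
(* The two components of [X] are nonzero root vectors themselves, hence the coefficients 1. If
   [i > j + 1] or [j > i + 1], one root would exceed the other in both coordinates. *)
exists i, j, 1, 1, x0, x1; split.
- have ij : (i <= j.+1)%N.
    rewrite leqNgt; apply/negP => ij.
    apply: (height_eq2_strict u0 v0 ej ei); apply: Fseq_homo => //; lia.
  have ji : (j <= i.+1)%N.
    rewrite leqNgt; apply/negP => ji.
    apply: (height_eq2_strict u0 v0 ei ej); apply: Fseq_homo => //; lia.
  by have [?|?|?] := ltngtP i j; [apply: Or31|apply: Or33|apply: Or32]; lia.
- by split=> //; apply/root_space2.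
- by split=> //; apply/root_space2.
- by rewrite !scale1r.
Qed.

Lemma real_pair_dominant (X Y H : g) (i j : nat) (c0 c1 : K) (E0 E1 : g) :
  is_sl2_triple X Y H -> [\/ i.+1 = j, i = j | i = j.+1] ->
  root_space (root2 (F i.+1) (F i)) E0 -> root_space (root2 (F j) (F j.+1)) E1 ->
  X = c0 *: E0 + c1 *: E1 -> Y = om X -> is_dominant H.
Proof.
move=> [[XN0 _ _] [_ _ [c _ HE]] [HX _ XY]] ij /root_space2 w0 /root_space2 w1 XE YE.
have Fi := Fseq_ge0_lt ha i; have Fj := Fseq_ge0_lt ha j.
set x0 := c0 *: E0 in XE; set x1 := c1 *: E1 in XE.
have {}w0 : wt a h0 h1 (F i.+1) (F i) x0 by exact: subspaceZ (wt_subspace _ _ _ _ _) _.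
have {}w1 : wt a h0 h1 (F j) (F j.+1) x1 by exact: subspaceZ (wt_subspace _ _ _ _ _) _.
have single p q : real_pos a p q -> wt a h0 h1 p q X -> False.
  move=> pq wX; have xE : lie X (om X) = cartan_elt A c by rewrite -YE XY.
  by have /eqP := not_single_real pq wX XN0 xE; apply; rewrite HE.
have x0N0 : x0 != 0.
  apply/eqP => x00; rewrite x00 add0r in XE; rewrite -XE in w1.
  by apply: single w1; exists j; right.
have x1N0 : x1 != 0.
  apply/eqP => x10; rewrite x10 addr0 in XE; rewrite -XE in w0.
  by apply: single w0; exists i; left.
exists c; first by rewrite HE.
set u := weight_eval A (simple_root 0) c; set v := weight_eval A (simple_root 1) c.
have evE (p q : int) : c 0 0 * (2 * p - a * q)%:~R + c 0 1 * (2 * q - a * p)%:~R =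
    u * p%:~R + v * q%:~R by rewrite -weight_eval2 weight_eval_simple.
move: HX; rewrite -HE cartan_elt2 XE lieDr (wt_lie_cartan _ _ w0) (wt_lie_cartan _ _ w1).
rewrite !evE scalerDr; set l0 := u * _ + _; set l1 := u * _ + _ => HX.
(* The eigenvalue equation relates vectors of two distinct weights, so both sides vanish and both
   roots take the value 2 at [H]. *)
have key : (l0 - 2) *: x0 = (2 - l1) *: x1.
  rewrite !scalerBl; apply/eqP; rewrite subr_eq addrAC -subr_eq opprK HX.
  by rewrite addrC.
have k0 : (l0 - 2) *: x0 = 0.
  apply: (wt_span_notin ha (W := fun p q => p = F j /\ q = F j.+1)
    (p := F i.+1) (q := F i)).
  - rewrite key; apply: subspaceZ (wt_span_subspace _ _ _ _) _.
    exact: wt_span_gen w1.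
  - exact: subspaceZ (wt_subspace _ _ _ _ _) _.
  - by case; lia.
have e0 : l0 = 2.
  by move: k0 => /eqP; rewrite scaler_eq0 (negbTE x0N0) orbF subr_eq0 => /eqP.
have e1 : l1 = 2.
  move: key; rewrite k0 => /esym/eqP; rewrite scaler_eq0 (negbTE x1N0) orbF subr_eq0.
  by move=> /eqP.
(* [D] is the determinant of the system [l0 = l1 = 2] in [u] and [v], solved below by Cramer's
   rule. *)
pose D : int := F i.+1 * F j.+1 - F i * F j.
have D0 : 0 < D%:~R :> K by rewrite ltr0z /D; nia.
(* The condition on [i] and [j] enters here: it makes both Cramer numerators nonnegative. *)
have Fij : F i <= F j.+1 /\ F j <= F i.+1.
  have [k3 k4] := (Fseq_ge0_lt ha i.+1, Fseq_ge0_lt ha j.+1).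
  by case: ij => ije; subst; lia.
have uD : D%:~R * u = 2 * (F j.+1 - F i)%:~R.
  rewrite /D !rmorphB !rmorphM /= mulrBr -{1}e0 -e1 /l0 /l1; ring.
have vD : D%:~R * v = 2 * (F i.+1 - F j)%:~R.
  rewrite /D !rmorphB !rmorphM /= mulrBr -{1}e1 -e0 /l0 /l1; ring.
move=> k; case: (ord2P k) => ->.
  by rewrite -/u -(pmulr_rge0 _ D0) uD mulr_ge0 ?ler0n // ler0z; lia.
by rewrite -/v -(pmulr_rge0 _ D0) vD mulr_ge0 ?ler0n // ler0z; lia.
Qed.

End Main.

Theorem theorem6p4 (R : realType) (a : int) (ha : 3 <= a)
    (omega0 : kac_moody R[i] (rank2_cartan a) -> kac_moody R[i] (rank2_cartan a))
    (homega0 : is_compact_involution omega0)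
    (X Y H : kac_moody R[i] (rank2_cartan a)) :
  (is_sl2_triple X Y H /\
   [/\ lin_span (@is_real_root_vector R[i] 2 (rank2_cartan a)) X,
       Y = omega0 X & is_dominant H])
  <->
  (is_sl2_triple X Y H /\
   exists (i j : nat) (c0 c1 : R[i])
          (E0 E1 : kac_moody R[i] (rank2_cartan a)),
     [/\ [\/ i.+1 = j, i = j | i = j.+1],
         E0 != 0 /\ root_space (root2 (Fseq a i.+1) (Fseq a i)) E0,
         E1 != 0 /\ root_space (root2 (Fseq a j) (Fseq a j.+1)) E1 &
         [/\ X = c0 *: E0 + c1 *: E1, Y = omega0 X & H = lie X Y]]).
Proof.
split=> -[sl2].
  by case=> Xreal YE Hdom; split=> //; exact: (dominant_real_span ha homega0 sl2).
move=> [i [j [c0 [c1 [E0 [E1 [ij [E0N0 w0] [E1N0 w1] [XE YE HE]]]]]]]].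
split=> //; split=> //; last exact: (real_pair_dominant ha homega0 sl2 ij w0 w1 XE YE).
rewrite XE; apply: (subspaceD (lin_span_subspace _)).
  apply: (subspaceZ _ (lin_span_subspace _)); apply: lin_span_gen.
  by apply: (real_pos_root_vector ha _ E0N0 w0); exists i; left.
apply: (subspaceZ _ (lin_span_subspace _)); apply: lin_span_gen.
by apply: (real_pos_root_vector ha _ E1N0 w1); exists j; right.
Qed.
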